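(* For every integer $k \geq 1$ there exists a finite set of graphs $\mathfrak{G}_k$ such that every minimally $k$-matchable graph is isomorphic to the disjoint union of an odd subdivision of some graph from $\mathfrak{G}_k$ and any number (possibly zero) of copies of $K_2$.
   Context: All graphs are finite and undirected; they may have multiple (parallel) edges but no loops. A perfect matching of a graph $G$ is a set of edges such that every vertex is an end vertex of exactly one of them; $\mathfrak{M}(G)$ denotes the set of perfect matchings of $G$. A graph $G$ is $k$-matchable if $|\mathfrak{M}(G)| \geq k$, and minimally $k$-matchable if it is $k$-matchable but $G-e$ is not $k$-matchable for every edge $e$ of $G$. An odd subdivision of a graph $G$ is any graph obtained from $G$ by replacing every edge $e$ by a path of odd length (possibly $1$) connecting the end vertices of $e$, such that all these paths are pairwise internally disjoint; in particular $G$ is an odd subdivision of itself. *)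

(* Defs.v *)
From HB Require Import structures.
From mathcomp Require Import all_boot.

Set Implicit Arguments.
Unset Strict Implicit.
Unset Printing Implicit Defensive.

(** Finite undirected multigraphs: edges form a type of their own, so parallel
    edges are allowed, and an edge has exactly two ends, so loops are not. *)
Record mgraph : Type := MGraph {
  vert : finType;
  edge : finType;
  ends : edge -> {set vert};
  card_ends : forall e, #|ends e| = 2
}.

Arguments ends {m} e.

Definition perfect_matching (G : mgraph) (M : {set edge G}) : bool :=
  [forall v : vert G, #|[set e in M | v \in ends e]| == 1].

Definition perfect_matchings (G : mgraph) : {set {set edge G}} :=
  [set M | perfect_matching M].

Definition matchable (k : nat) (G : mgraph) : Prop :=
  k <= #|perfect_matchings G|.

Definition del_edge (G : mgraph) (e : edge G) : mgraph :=
  @MGraph (vert G) {e' : edge G | e' != e}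
    (fun e' => ends (val e')) (fun e' => card_ends (val e')).

Definition minimally_matchable (k : nat) (G : mgraph) : Prop :=
  matchable k G /\ forall e : edge G, ~ matchable k (del_edge e).

Definition isomorphic (G H : mgraph) : Prop :=
  exists (f : vert G -> vert H) (g : edge G -> edge H),
    [/\ bijective f, bijective g & forall e, ends (g e) = f @: ends e].

Definition dunion_ends (G H : mgraph) (e : edge G + edge H) : {set vert G + vert H} :=
  match e with
  | inl a => inl @: ends a
  | inr b => inr @: ends b
  end.

Lemma card_dunion_ends (G H : mgraph) (e : edge G + edge H) : #|dunion_ends e| = 2.
Proof.
by case: e => e /=; rewrite card_imset ?card_ends // => x y [].
Qed.

Definition dunion (G H : mgraph) : mgraph := MGraph (@card_dunion_ends G H).

Definition copies_ends (n : nat) (G : mgraph) (e : 'I_n * edge G) : {set 'I_n * vert G} :=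
  pair e.1 @: ends e.2.

Lemma card_copies_ends (n : nat) (G : mgraph) (e : 'I_n * edge G) :
  #|copies_ends e| = 2.
Proof. by rewrite card_imset ?card_ends // => x y []. Qed.

Definition copies (n : nat) (G : mgraph) : mgraph :=
  MGraph (@card_copies_ends n G).

Lemma card_K2_ends (e : unit) : #|[set: bool]| = 2.
Proof. by rewrite cardsT card_bool. Qed.

Definition K2 : mgraph := MGraph card_K2_ends.

(** A walk starting at [x] is given by the list of its successive steps
    (edge traversed, vertex reached); its length is the size of that list. *)
Fixpoint is_walk (G : mgraph) (x : vert G) (s : seq (edge G * vert G)) : bool :=
  if s is (e, y) :: s' then (ends e == [set x; y]) && is_walk y s' else true.

Definition is_path (G : mgraph) (x : vert G) (s : seq (edge G * vert G)) : bool :=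
  is_walk x s && uniq (x :: unzip2 s).

Definition path_end (G : mgraph) (x : vert G) (s : seq (edge G * vert G)) :=
  last x (unzip2 s).

Definition path_edges (G : mgraph) (s : seq (edge G * vert G)) := unzip1 s.

Definition path_inner (G : mgraph) (x : vert G) (s : seq (edge G * vert G)) :=
  behead (belast x (unzip2 s)).

(** [H] is obtained from [G] by replacing every edge [e] by the odd path
    [start e, steps e]; [f] embeds the vertices of [G] into [H].  The last
    condition also forces parallel edges replaced by paths of length 1 to be
    replaced by distinct edges. *)
Definition odd_subdivision (G H : mgraph) : Prop :=
  exists (f : vert G -> vert H)
         (start : edge G -> vert H)
         (steps : edge G -> seq (edge H * vert H)),
    let inner e := path_inner (start e) (steps e) in
    [/\ injective f,
        forall e, [/\ is_path (start e) (steps e),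
                      odd (size (steps e))
                    & [set start e; path_end (start e) (steps e)] = f @: ends e],
        forall e v, v \in inner e -> v \notin codom f,
        forall e e' v, v \in inner e -> v \in inner e' -> e = e'
      & (forall v, v \in codom f \/ exists e, v \in inner e) /\
        (forall h, exists! e, h \in path_edges (steps e))].

(* Main.v *)
(** If [G] is minimally [k]-matchable, every edge lies in a perfect matching and
    [G] has at most [2k] of them: at a vertex with two edges [e] and [f], every
    perfect matching avoids [e] or [f], and fewer than [k] avoid a given edge.
    It then suffices to bound the number of vertices of degree at least 3; the
    remaining degree-2 vertices are removed two at a time, replacing odd paths
    by edges.

    Such a vertex has three distinct edges belonging to perfect matchings [M], [X]
    and [Y].  It lies on a cycle [Z] of the symmetric difference of [M] and [X],
    and there are few such cycles since switching [M] along each of them gives a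
    perfect matching.  The [Y]-edges leaving [Z] extend, alternating between [Y]
    and [M], to ears of [Z]; the ends of the ears alternate in colour along the
    bipartite cycle [Z], and a set of ears whose ends still alternate extends to
    a perfect matching of [G].  So [Z] and its ears form a chord diagram, and a
    chord diagram with many chords has many alternating subsets. *)

Require Import Defs.
From Stdlib Require List.
From mathcomp Require Import all_boot.
From mathcomp Require Import zify.

Set Implicit Arguments.
Unset Strict Implicit.
Unset Printing Implicit Defensive.

(** The reduction carries [few_matchings] along instead of minimality: splitting off [K2] components
    and suppressing two vertices both send perfect matchings to perfect matchings in either
    direction. Bounds come from relating objects to matchings, or to alternating sets, in such a way
    that the latter determine the former.

    The obstacle in the chord diagram is the ladder-like pattern, which has no small alternating
    subsets. Away from small alternating sets, neighbouring chords have opposite parity and so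
    cannot cross. Those leaving a block are therefore nested, and then removing two adjacent rungs
    leaves a large alternating set. Small or large, alternating sets are numerous.

    The other obstacle is the absence of loops: suppressing [u] and [v] on a path [a u v b] requires
    [a != b]. Vertices whose matching edge has a parallel edge are set aside, and the path is
    started along a matching edge so that a triangle cannot arise. *)

Lemma card_rel_inj_in (I A : finType) (D : {set I}) (P : {set A}) (R : I -> A -> Prop) :
  (forall i, i \in D -> exists2 x, x \in P & R i x) ->
  (forall i j x, R i x -> R j x -> i = j) -> #|D| <= #|P|.
Proof.
move=> exR injR; have [->|/set0Pn[i0 i0D]] := eqVneq D set0; first by rewrite cards0.
have [x0 _ _] := exR i0 i0D.
have [f fP] : exists f : I -> A, forall i, i \in D -> f i \in P /\ R i (f i).
  apply: (@fin_all_exists I (fun=> A) (fun i x => i \in D -> x \in P /\ R i x)) => i.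
  by case: (boolP (i \in D)) => [/exR[x xP Rx]|_]; [exists x|exists x0].
have f_inj : {in D &, injective f}.
  move=> i j /fP[_ Ri] /fP[_ Rj] e; apply: (injR i j (f i)) => //; by rewrite e.
rewrite -(card_in_imset f_inj); apply: subset_leq_card; apply/subsetP => _ /imsetP[i iD ->].
by have [] := fP i iD.
Qed.

Lemma card_rel_inj (I A : finType) (P : {set A}) (R : I -> A -> Prop) :
  (forall i, exists2 x, x \in P & R i x) ->
  (forall i j x, R i x -> R j x -> i = j) -> #|I| <= #|P|.
Proof. by move=> exR; rewrite -cardsT; apply: card_rel_inj_in. Qed.

(** * Chord diagrams *)

Section Chords.
Variables (m : nat) (tau : 'I_m -> 'I_m).
Hypothesis tauK : involutive tau.
Hypothesis tau_neq : forall i, tau i != i.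
Hypothesis m_even : ~~ odd m.

Definition before (S : {set 'I_m}) (k : nat) := #|[set j in S | j < k]|.

(* [S] is a union of chords [{i, tau i}] whose ends, in increasing order,
   alternate in parity. *)
Definition alternating (S : {set 'I_m}) : bool :=
  [&& [forall i in S, tau i \in S], ~~ odd #|S| &
      [exists d : bool, forall i in S, odd (before S i) == odd i (+) d]].

Lemma alternatingP (S : {set 'I_m}) :
  reflect [/\ forall i, i \in S -> tau i \in S, ~~ odd #|S| &
            exists d, forall i, i \in S -> odd (before S i) = odd i (+) d]
          (alternating S).
Proof.
apply: (iffP and3P) => [[cS eS /existsP[d dS]]|[cS eS [d dS]]].
  split=> //; first by move=> i; move/forall_inP: cS; apply.
  by exists d => i iS; apply/eqP; move/forall_inP: dS; apply.
split=> //; first exact/forall_inP.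
by apply/existsP; exists d; apply/forall_inP => i /dS ->.
Qed.

Lemma before_seq (s : seq 'I_m) k :
  uniq s -> before [set x in s] k = count (fun j : 'I_m => j < k) s.
Proof.
move=> us; rewrite -size_filter -(card_uniqP (filter_uniq _ us)) /before.
by apply: eq_card => j; rewrite !inE mem_filter andbC.
Qed.

Lemma before_compl S k : k <= m -> before S k + before (~: S) k = k.
Proof.
move=> lek; have -> : before S k = #|[set j : 'I_m | j < k] :&: S|.
  by apply: eq_card => j; rewrite !inE andbC.
have -> : before (~: S) k = #|[set j : 'I_m | j < k] :\: S|.
  by apply: eq_card => j; rewrite !inE.
rewrite cardsID -[RHS]card_ord.
rewrite -(card_imset predT (f := widen_ord lek)); last first.
  by move=> x y /(congr1 val) /= /val_inj.
apply: eq_card => j; rewrite !inE; apply/idP/imsetP => [lt|[x _ ->]]; last exact: (ltn_ord x).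
by exists (Ordinal lt) => //; apply: val_inj.
Qed.

(** Four is the size of two chords: the configurations to be excluded, a chord with ends of unlike
    parity or two crossing chords of unlike parity, alternate by themselves. *)
Definition short_support : {set 'I_m} :=
  cover [set S : {set 'I_m} | alternating S && (#|S| <= 4)].

Let T := short_support.

Lemma card_short_support : #|T| <= 4 * #|[set S | alternating S]|.
Proof.
apply: leq_trans (leq_card_cover _).1 _.
apply: (@leq_trans (\sum_(S in [set S : {set 'I_m} | alternating S && (#|S| <= 4)]) 4)).
  by apply: leq_sum => S; rewrite inE => /andP[].
rewrite sum_nat_const mulnC leq_mul2l subset_leq_card //.
by apply/subsetP => S; rewrite !inE => /andP[].
Qed.

Lemma short_supportI (S : {set 'I_m}) i : alternating S -> #|S| <= 4 -> i \in S -> i \in T.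
Proof. by move=> aS cS iS; apply/bigcupP; exists S; rewrite ?inE ?aS. Qed.

Lemma tau_short_support i : i \in T -> tau i \in T.
Proof.
case/bigcupP=> S; rewrite inE => /andP[aS cS] iS.
apply: (short_supportI aS cS); by case/alternatingP: aS => + _ _; apply.
Qed.

Lemma tauN_short_support i : i \notin T -> tau i \notin T.
Proof. by apply: contra => /tau_short_support; rewrite tauK. Qed.

(** A chord whose ends differ in parity is an alternating set of size 2. *)
Lemma odd_tau i : i \notin T -> odd (tau i) = odd i.
Proof.
move=> iT; apply/eqP; apply: contraNT iT => ne.
have us : uniq [:: i; tau i] by rewrite /= inE eq_sym tau_neq.
have /eqP ne_i := tau_neq i.
have cS : #|[set x in [:: i; tau i]]| = 2 by rewrite cardsE (card_uniqP us).
apply: (@short_supportI [set x in [:: i; tau i]]); rewrite ?cS ?inE ?eqxx //.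
apply/alternatingP; split; rewrite ?cS //.
  by move=> j; rewrite !inE => /orP[/eqP->|/eqP->]; rewrite ?tauK eqxx ?orbT.
have nv : (tau i : nat) != i by apply/eqP => /val_inj.
exists (odd i (+) (tau i < i)) => j; rewrite before_seq //= !inE.
by case/orP => /eqP ->; lia.
Qed.

(** Read in increasing order, the four ends have the parities of [i], [j], [i], [j], so the two
    chords together alternate. *)
Lemma crossing_short (i j : 'I_m) :
  odd (tau i) = odd i -> odd (tau j) = odd j -> odd i != odd j ->
  i < j -> j < tau i -> tau i < tau j -> (i \in T) && (j \in T).
Proof.
move=> oi oj oij ij jti titj.
have us : uniq [:: i; j; tau i; tau j].
  rewrite /= !inE !negb_or; apply/and4P; split=> //; first apply/and3P; try split;
  by try (apply/andP; split); apply/eqP => /(congr1 val) /=; lia.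
have cS : #|[set x in [:: i; j; tau i; tau j]]| = 4 by rewrite cardsE (card_uniqP us).
have aS : alternating [set x in [:: i; j; tau i; tau j]].
  apply/alternatingP; split; rewrite ?cS //.
    by move=> k; rewrite !inE => /or4P[]/eqP->; rewrite ?tauK eqxx ?orbT.
  have lts : ((j < i) = false) * ((tau i < i) = false) * ((tau j < i) = false) *
      ((tau i < j) = false) * ((tau j < j) = false) * ((tau j < tau i) = false) *
      (i < tau i) * (i < tau j) * (j < tau j).
    by clear -ij jti titj; do !split; lia.
  exists (odd i) => k; rewrite before_seq //= !inE.
  case/or4P => /eqP ->; rewrite ?ltnn ?lts ?ij ?jti ?titj ?oi ?oj /=.
  - by rewrite addbb.
  - by move: oij; case: (odd i); case: (odd j).
  - by rewrite addbb.
  - by move: oij; case: (odd i); case: (odd j).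
by rewrite !(@short_supportI _ _ aS) ?cS // !inE eqxx ?orbT.
Qed.

Definition free (a b : nat) := forall z : 'I_m, a <= z <= b -> z \notin T.

(* The chord at [i.+1] may not cross the chord at [i], so it is nested in it:
   infinite descent. *)
Lemma free_no_chord (i : 'I_m) : i < tau i -> ~ free i (tau i).
Proof.
have [n] := ubnP (tau i - i); elim: n i => // n IH i le_n lt_i fr.
have iT : i \notin T by apply: fr; lia.
have oi := odd_tau iT.
have lt_j : i.+1 < m by have := ltn_ord (tau i); lia.
pose j := Ordinal lt_j; have ej : j = i.+1 :> nat by [].
have jT : j \notin T by apply: fr; lia.
have oj := odd_tau jT.
have lt_jti : j < tau i by clear -oi ej lt_i; lia.
have oij : odd i != odd j by rewrite ej /=; case: (odd i).
have ne_j : (tau j : nat) != j by apply/eqP => /val_inj/eqP; rewrite (negPf (tau_neq j)).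
have ne_ji : (tau j : nat) != i.
  apply/eqP => /val_inj e; have : tau (tau j) = tau i by rewrite e.
  by rewrite tauK => /(congr1 val) /=; lia.
have ne_jt : (tau j : nat) != tau i.
  by apply/eqP => /val_inj/(can_inj tauK)/(congr1 val) /=; lia.
case: (ltnP (tau i) (tau j)) => [lt|le].
  have := @crossing_short i j oi oj oij; rewrite (negPf iT) /=; clear oi oj oij => H.
  by have := H ltac:(lia) ltac:(lia) lt.
case: (ltnP (tau j) i) => [lt|ge].
  have := @crossing_short (tau j) i; rewrite (negPf iT) andbF tauK => H.
  have {}H := H (esym oj) oi ltac:(by rewrite oj eq_sym); clear oi oj oij.
  by have := H ltac:(lia) ltac:(lia) ltac:(lia).
apply: (IH j); [lia|lia|].
by move=> z hz; apply: fr; lia.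
Qed.

Lemma free_tau_out a b (z : 'I_m) : free a b -> a <= z <= b -> (tau z < a) || (b < tau z).
Proof.
move=> fr hz; apply: contraT; rewrite negb_or => hh.
have ne : (tau z : nat) != z by apply/eqP => /val_inj/eqP; rewrite (negPf (tau_neq z)).
case: (ltnP z (tau z)) => lt.
  by case: (@free_no_chord z) => // y hy; apply: fr; lia.
case: (@free_no_chord (tau z)); rewrite tauK; first by lia.
by move=> y hy; apply: fr; lia.
Qed.

(** The chords at [i] and [j] have opposite parity and may not cross. A partner of [i] to the right
    of the block, or one below [tau j], would make them cross. *)
Lemma free_left a b (i j : 'I_m) :
  free a b -> a <= i -> j = i.+1 :> nat -> j <= b -> tau j < a ->
  tau i < a /\ tau j < tau i.
Proof.
move=> fr ai ij jb tj.
have iT : i \notin T by apply: fr; lia.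
have jT : j \notin T by apply: fr; lia.
have oi := odd_tau iT; have oj := odd_tau jT.
have oij : odd i != odd j by rewrite ij /=; case: (odd i).
have ne_jt : (tau j : nat) != tau i.
  by apply/eqP => /val_inj/(can_inj tauK)/(congr1 val) /=; lia.
have := @free_tau_out a b i fr ltac:(lia); case: (ltnP (tau i) a) => /= [lt _|_ gt].
  split=> //; case: (ltnP (tau j) (tau i)) => // le.
  have := @crossing_short (tau i) (tau j); rewrite (negPf (tauN_short_support iT)) !tauK => H.
  have {}H := H (esym oi) (esym oj) ltac:(by rewrite oi oj); clear oi oj oij.
  by have := H ltac:(lia) ltac:(lia) ltac:(lia).
have := @crossing_short (tau j) i; rewrite (negPf iT) andbF tauK => H.
have {}H := H (esym oj) oi ltac:(by rewrite oj eq_sym); clear oi oj oij.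
by have := H ltac:(lia) ltac:(lia) ltac:(lia).
Qed.

(** Mirror image of [free_left]: here the side is passed on from [i] to its successor, there from
    [j] to its predecessor. *)
Lemma free_right a b (i j : 'I_m) :
  free a b -> a <= i -> j = i.+1 :> nat -> j <= b -> b < tau i ->
  b < tau j /\ tau j < tau i.
Proof.
move=> fr ai ij jb ti.
have iT : i \notin T by apply: fr; lia.
have jT : j \notin T by apply: fr; lia.
have oi := odd_tau iT; have oj := odd_tau jT.
have oij : odd i != odd j by rewrite ij /=; case: (odd i).
have ne_jt : (tau j : nat) != tau i.
  by apply/eqP => /val_inj/(can_inj tauK)/(congr1 val) /=; lia.
have := @free_tau_out a b j fr ltac:(lia); case: (ltnP b (tau j)) => /= [lt _|_]; last first.
  rewrite orbF => gt.
  have := @crossing_short (tau j) i; rewrite (negPf iT) andbF tauK => H.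
  have {}H := H (esym oj) oi ltac:(by rewrite oj eq_sym); clear oi oj oij.
  by have := H ltac:(lia) ltac:(lia) ltac:(lia).
split=> //; case: (ltnP (tau j) (tau i)) => // le.
have := @crossing_short i j oi oj oij; rewrite (negPf iT); clear oi oj oij => H.
by have := H ltac:(lia) ltac:(lia) ltac:(lia).
Qed.

(* [tau] decreases along [tau j .. tau i] as well, so nothing fits strictly
   between the values [j] and [i] that it takes at the two bounds. *)
Lemma free_adjacent (i j : 'I_m) :
  j = i.+1 :> nat -> tau j < tau i -> free (tau j) (tau i) -> tau i = (tau j).+1 :> nat.
Proof.
move=> ij lt fr.
have o1 := @free_tau_out _ _ (tau i) fr ltac:(lia).
have o2 := @free_tau_out _ _ (tau j) fr ltac:(lia).
rewrite !tauK in o1 o2.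
case: (ltnP i (tau j)) => side.
  have H n : forall z : 'I_m, tau j <= z -> z + n = tau i -> tau z < tau j /\ i + n <= tau z.
    elim: n => [|n IH] z hz ez.
      by have -> : z = tau i; [apply: val_inj => /=; lia|rewrite tauK; lia].
    have lt_z : z.+1 < m by have := ltn_ord (tau i); lia.
    have [h1 h2] := IH (Ordinal lt_z) ltac:(rewrite /=; lia) ltac:(rewrite /=; lia).
    have := @free_left _ _ z (Ordinal lt_z) fr hz erefl ltac:(rewrite /=; lia) h1.
    lia.
  have := H (tau i - tau j) (tau j) (leqnn _) ltac:(lia); rewrite tauK; lia.
have H n : forall z : 'I_m, z <= tau i -> tau j + n = z :> nat -> tau i < tau z /\ tau z + n <= j.
  elim: n => [|n IH] z hz ez.
    by have -> : z = tau j; [apply: val_inj => /=; lia|rewrite tauK; lia].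
  have lt_z : tau j + n < m by have := ltn_ord (tau i); lia.
  have [h1 h2] := IH (Ordinal lt_z) ltac:(rewrite /=; lia) ltac:(rewrite /=; lia).
  have := @free_right _ _ (Ordinal lt_z) z fr ltac:(rewrite /=; lia) ltac:(rewrite /=; lia) hz h1.
  lia.
have := H (tau i - tau j) (tau i) (leqnn _) ltac:(lia); rewrite tauK; lia.
Qed.

(** The removed points form two pairs of neighbours, so an even number of them lies below any
    remaining point. Its rank in the complement thus has the parity of the point itself, and the
    shift is [false]. *)
Lemma alternating_compl_pair (i j : 'I_m) :
  j = i.+1 :> nat -> tau i = (tau j).+1 :> nat -> i \notin T ->
  alternating (~: [set x in [:: i; j; tau j; tau i]]).
Proof.
move=> ij tij iT.
have oi := odd_tau iT.
have ni : (tau i : nat) != i by apply/eqP => /val_inj/eqP; rewrite (negPf (tau_neq i)).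
have nj : (tau j : nat) != j by apply/eqP => /val_inj/eqP; rewrite (negPf (tau_neq j)).
have us : uniq [:: i; j; tau j; tau i].
  rewrite /= !inE !negb_or; apply/and4P; split=> //; first apply/and3P; try split;
  by try (apply/andP; split); apply/eqP => /(congr1 val) /=; lia.
have cD : #|[set x in [:: i; j; tau j; tau i]]| = 4 by rewrite cardsE (card_uniqP us).
apply/alternatingP; split.
- move=> k; rewrite !inE; apply: contra => /or4P[]/eqP e;
    by rewrite -(tauK k) e ?tauK eqxx ?orbT.
- have := cardsC [set x in [:: i; j; tau j; tau i]]; rewrite card_ord cD.
  by move=> /(congr1 odd); rewrite oddD /= => ->.
- exists false => k; rewrite !inE !negb_or => /and4P[k1 k2 k3 k4].
  have {}k1 : (k : nat) != i by []. have {}k2 : (k : nat) != j by [].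
  have {}k3 : (k : nat) != tau j by []. have {}k4 : (k : nat) != tau i by [].
  have := @before_compl [set x in [:: i; j; tau j; tau i]] k (ltnW (ltn_ord k)).
  have e1 : (j < k) = (i < k) by clear -ij k1 k2; lia.
  have e2 : (tau i < k) = (tau j < k) by clear -tij k3 k4; lia.
  move=> /(congr1 odd); rewrite oddD before_seq //= e1 e2 addn0.
  by rewrite addnA addnACA !oddD !addbb addbF.
Qed.

(** Each of the [L - 1] pairs of neighbours is charged to a point of [T] between their partners or,
    if there is none, to the alternating complement of the two rungs. Either charge determines the
    pair. *)
Lemma decreasing_block_bound L a :
  a + L <= m -> (forall z : 'I_m, a <= z < a + L -> z \notin T) ->
  (forall i j : 'I_m, a <= i -> j = i.+1 :> nat -> j < a + L -> tau j < tau i) ->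
  L <= #|T| + #|[set S | alternating S]| + 1.
Proof.
move=> aLm fr dec.
case: L aLm fr dec => // L aLm fr dec.
have lt_o (n : 'I_L.+1) : a + n < m by have := ltn_ord n; lia.
pose o n := Ordinal (lt_o n).
(* The length has become [L.+1], so the closed interval from [a] to [a + L] is the whole block. *)
have freeo : free a (a + L) by move=> z hz; apply: fr; lia.
have oT (n : 'I_L.+1) : o n \notin T by apply: fr => /=; have := ltn_ord n; lia.
have out (n n' : 'I_L.+1) : o n <> tau (o n').
  move=> e; have := @free_tau_out _ _ (o n') freeo; rewrite -e /=.
  by have := ltn_ord n; have := ltn_ord n'; lia.
have dec_o d (n n' : 'I_L.+1) : n + d.+1 = n' :> nat -> tau (o n') < tau (o n).
  elim: d n' => [|d IH] n' e.
    by apply: dec => /=; have := ltn_ord n'; lia.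
  have lt_p : n + d.+1 < L.+1 by have := ltn_ord n'; lia.
  have := IH (Ordinal lt_p) erefl; apply: ltn_trans.
  by apply: dec => /=; have := ltn_ord n'; lia.
pose lo (n : 'I_L) := o (widen_ord (leqnSn L) n); pose hi (n : 'I_L) := o (lift ord0 n).
have hiE n : hi n = (lo n).+1 :> nat by rewrite /= /bump /=; lia.
have dec_n n : tau (hi n) < tau (lo n) by apply: (dec_o 0); rewrite /= /bump /=; lia.
pose R (n : 'I_L) (x : 'I_m + {set 'I_m}) := match x with
  | inl t => t \in T /\ tau (hi n) <= t <= tau (lo n)
  | inr B => B = ~: [set x in [:: lo n; hi n; tau (hi n); tau (lo n)]] end.
rewrite addn1 ltnS -[L in L <= _]card_ord.
apply: (@leq_trans #|inl @: T :|: inr @: [set S | alternating S]|); last first.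
  by apply: leq_trans (leq_card_setU _ _) _; rewrite !card_imset // => ? ? [].
apply: (@card_rel_inj _ _ _ R) => [n|n n' [t|B]].
- case: (pickP (fun t : 'I_m => (t \in T) && (tau (hi n) <= t <= tau (lo n)))) =>
      [t /andP[tT ht]|none].
    by exists (inl t) => //; rewrite inE imset_f.
  exists (inr (~: [set x in [:: lo n; hi n; tau (hi n); tau (lo n)]])) => //.
  rewrite inE; apply/orP; right; apply: imset_f; rewrite inE.
  apply: (alternating_compl_pair (hiE n) _ (oT _)).
  apply: (free_adjacent (hiE n)) => //.
  by move=> z hz; have := none z; rewrite hz andbT => ->.
(* The partner intervals of two pairs share at most the end [tau (hi p)], which is outside [T]
   because [hi p] is. *)
- have aux (p q : 'I_L) : p < q -> R p (inl t) -> R q (inl t) -> False.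
    move=> pq [tT h1] [_ h2].
    have e : tau (lo q) <= tau (hi p).
      have [epq|lt] := eqVneq (p.+1) q.
        by have -> : lo q = hi p by apply: val_inj; rewrite /= /bump /=; lia.
      apply: ltnW; apply: (dec_o (q - p).-2).
      by rewrite /= /bump /=; move: lt pq => /eqP; lia.
    have te : t = tau (hi p) by apply: val_inj => /=; lia.
    by move: tT; rewrite te (negPf (tauN_short_support (oT _))).
  move=> h1 h2; apply: val_inj; case: (ltngtP n n') => // lt.
    by case: (aux _ _ lt h1 h2).
  by case: (aux _ _ lt h2 h1).
(* Equal complements mean the same four points. By [out] none of the partners lies in the block, so
   the two block positions must agree as well. *)
- move=> /= e1 e2; apply: val_inj => /=.
  have eD : [set x in [:: lo n; hi n; tau (hi n); tau (lo n)]] =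
            [set x in [:: lo n'; hi n'; tau (hi n'); tau (lo n')]].
    by apply: setC_inj; rewrite -e1 -e2.
  have : lo n \in [set x in [:: lo n; hi n; tau (hi n); tau (lo n)]] by rewrite !inE eqxx.
  have : hi n \in [set x in [:: lo n; hi n; tau (hi n); tau (lo n)]] by rewrite !inE eqxx !orbT.
  rewrite eD !inE => /or4P[]/eqP h; try by case: (out _ _ h).
    move=> /or4P[]/eqP h'; try by case: (out _ _ h').
      by have := congr1 val h; have := congr1 val h'; rewrite /= /bump /=; lia.
    by have := congr1 val h; have := congr1 val h'; rewrite /= /bump /=; lia.
  move=> _; by have := congr1 val h; rewrite /= /bump /=; lia.
Qed.

(** The middle chord leaves the block on one side. If it goes left, so do all chords of the first
    half; if right, all those of the second half. On that half of length [L], [tau] decreases. *)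
Lemma free_block_bound L a :
  0 < L -> a + 2 * L <= m -> free a (a + 2 * L).-1 ->
  L <= #|T| + #|[set S | alternating S]| + 1.
Proof.
move=> L0 aLm fr.
have lt_h : a + L < m by lia.
pose h := Ordinal lt_h.
have := @free_tau_out _ _ h fr ltac:(rewrite /=; lia).
case/orP => side.
  have left n : forall z : 'I_m, a <= z -> z + n = h -> tau z < a.
    elim: n => [|n IH] z az e.
      by have -> : z = h by apply: val_inj => /=; rewrite /= in e; lia.
    have lt_z : z.+1 < m by have := ltn_ord h; lia.
    have lz := IH (Ordinal lt_z) ltac:(rewrite /=; lia) ltac:(rewrite /= in e *; lia).
    by have [] := @free_left _ _ z (Ordinal lt_z) fr az erefl ltac:(rewrite /= in e *; lia) lz.
  apply: (@decreasing_block_bound L a); first by lia.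
    by move=> z hz; apply: fr; lia.
  move=> i j ai ij jL.
  have lj := left (h - j) j ltac:(lia) ltac:(rewrite /=; lia).
  by have [] := @free_left _ _ i j fr ai ij ltac:(lia) lj.
have right n : forall z : 'I_m, z < a + 2 * L -> h + n = z -> (a + 2 * L).-1 < tau z.
  elim: n => [|n IH] z az e.
    by have -> : z = h by apply: val_inj => /=; rewrite /= in e; lia.
  have lt_z : h + n < m by have := ltn_ord z; lia.
  have lz := IH (Ordinal lt_z) ltac:(rewrite /= in e *; lia) erefl.
  by have [] := @free_right _ _ (Ordinal lt_z) z fr ltac:(rewrite /=; lia)
       ltac:(rewrite /= in e *; lia) ltac:(lia) lz.
apply: (@decreasing_block_bound L (a + L)); first by lia.
  by move=> z hz; apply: fr; lia.
move=> i j ai ij jL.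
have li := right (i - h) i ltac:(lia) ltac:(rewrite /=; lia).
by have [] := @free_right _ _ i j fr ltac:(lia) ij ltac:(lia) li.
Qed.

(* Off the at most [4 N] points lying on short alternating sets there is a long
   block on which [tau] decreases; consecutive chords starting there form ladder
   rungs, and the complement of two adjacent rungs is alternating. *)
Lemma chord_bound N :
  #|[set S | alternating S]| <= N -> m < (4 * N).+1 * (2 * (5 * N + 2)).
Proof.
move=> leN; rewrite ltnNge; apply/negP => le_m.
have := card_short_support; rewrite -/T => leT.
(* At most [4 * N] points of [T], [N] alternating sets and 1 add up to less than [L]. So each of the
   [4 * N + 1] disjoint blocks of length [2 * L] meets [T], which is too small for that. *)
set L := 5 * N + 2 in le_m.
suff : #|'I_(4 * N).+1| <= #|T| by rewrite card_ord; lia.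
apply: (@card_rel_inj _ _ _ (fun (q : 'I_(4 * N).+1) (t : 'I_m) =>
  q * (2 * L) <= t < q * (2 * L) + 2 * L)).
  move=> q.
  case: (pickP (fun t : 'I_m => (t \in T) && (q * (2 * L) <= t < q * (2 * L) + 2 * L))) =>
      [t /andP[tT ht]|none].
    by exists t.
  have lt_q : q * (2 * L) + 2 * L <= m.
    apply: leq_trans le_m; rewrite -mulSnr leq_mul2r.
    by rewrite (ltn_ord q) orbT.
  have : L <= #|T| + #|[set S | alternating S]| + 1; last by rewrite /L; lia.
  apply: (@free_block_bound L (q * (2 * L))) => //; first by rewrite /L; lia.
  move=> z hz; have := none z; case: (z \in T) => //=.
  by move: hz; rewrite /L; lia.
move=> q q' t hq hq'; apply: val_inj => /=.
have l0 : 0 < 2 * L by rewrite /L; lia.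
have aux (p : nat) : p * (2 * L) <= t < p * (2 * L) + 2 * L -> t %/ (2 * L) = p.
  move=> /andP[h1 h2]; rewrite -(subnKC h1) divnMDl // divn_small ?addn0 //; lia.
by rewrite -(aux _ hq) -(aux _ hq').
Qed.

End Chords.

Lemma card_bigcup_le (I T : finType) (P : {set I}) (F : I -> {set T}) (W : {set T}) k :
  (forall v, v \in W -> exists2 i, i \in P & v \in F i) ->
  (forall i, i \in P -> #|F i| <= k) -> #|W| <= #|P| * k.
Proof.
move=> covW leF; apply: (@leq_trans (\sum_(i in P) #|F i|)); last first.
  by rewrite -sum_nat_const; apply: leq_sum.
rewrite (@eq_bigr _ _ _ _ _ _ _ (fun i => \sum_(v | v \in F i) 1)); last first.
  by move=> i _; rewrite sum1_card.
rewrite (exchange_big_dep predT) //= -sum1_card big_mkcond /=.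
apply: leq_sum => v _; case: ifP => // /covW[i iP vF].
by rewrite (bigD1 i) ?iP //=.
Qed.

(** * Perfect matchings and ears *)

Section TwoInvolutions.
Variables (T : finType) (alpha beta : T -> T).
Hypotheses (alphaK : involutive alpha) (alpha_neq : forall x, alpha x != x).
Hypothesis betaK : involutive beta.

(** In the application [alpha] is the partner under [m2], and [beta] the partner under [m0] off the
    cycle and the identity on it. The orbit of a cycle vertex is then the vertex set of the ear
    starting there. *)
Definition ear_step x := beta (alpha x).
Local Notation rho := ear_step.

(* When [beta] fixes [w], it acts on the [rho]-orbit of [w] as the reflection
   [k |-> - k], whose only other fixed point is the antipode of [w]. *)
Definition ear_end w := iter (order rho w)./2 rho w.

Lemma ear_step_inj : injective rho.
Proof. by rewrite /rho => x y /(can_inj betaK)/(can_inj alphaK). Qed.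

(** The dihedral relation: [beta] conjugates [rho] to its inverse. *)
Let iter_betaK k w : iter k rho (beta (iter k rho w)) = beta w.
Proof.
elim: k w => //= k IH w; rewrite -iterS iterSr.
have -> : rho (beta (rho (iter k rho w))) = beta (iter k rho w) by rewrite /rho betaK alphaK.
exact: IH.
Qed.

Let iter_inj k : injective (iter k rho).
Proof. by elim: k => [|k IH] x y //= /ear_step_inj/IH. Qed.

Let beta_iter k w : beta w = w -> k <= order rho w ->
  beta (iter k rho w) = iter (order rho w - k) rho w.
Proof.
move=> bw lek; apply: (@iter_inj k).
by rewrite iter_betaK bw -iterD subnKC // (iter_order ear_step_inj).
Qed.

Let iter_eq k l w : k < order rho w -> l < order rho w ->
  iter k rho w = iter l rho w -> k = l.
Proof. by move=> hk hl e; rewrite -(findex_iter hk) -(findex_iter hl) e. Qed.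

Lemma ear_beta w x : beta w = w -> fconnect rho w x -> fconnect rho w (beta x).
Proof.
move=> bw cx; rewrite -(iter_findex cx) beta_iter ?fconnect_iter //.
exact/ltnW/findex_max.
Qed.

Lemma ear_alpha w x : beta w = w -> fconnect rho w x -> fconnect rho w (alpha x).
Proof.
move=> bw cx; have -> : alpha x = beta (rho x) by rewrite /rho betaK.
by apply: ear_beta => //; rewrite -(same_fconnect1_r ear_step_inj).
Qed.

(** On an orbit of length [2k + 1], [alpha] would fix the [k]-th iterate of [w], but it has no fixed
    points. *)
Let order_even w : beta w = w -> odd (order rho w) = false.
Proof.
move=> bw; apply/negP => od; set k := (order rho w)./2.
have ek : order rho w = (k + k).+1 by rewrite addnn -[LHS]odd_double_half od.
have := alpha_neq (iter k rho w); rewrite -[alpha _]betaK -/(rho _) -iterS beta_iter //; last lia.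
by rewrite (_ : order rho w - k.+1 = k) ?eqxx //; lia.
Qed.

Lemma ear_end_fix w : beta w = w -> beta (ear_end w) = ear_end w.
Proof.
move=> bw; rewrite /ear_end beta_iter //; last by have := odd_double_half (order rho w); lia.
congr iter; have := odd_double_half (order rho w); rewrite order_even //; lia.
Qed.

Lemma ear_end_neq w : beta w = w -> ear_end w != w.
Proof.
move=> bw; apply/eqP => e; have := odd_double_half (order rho w); rewrite order_even //.
have := order_gt0 rho w => o0 eo.
have := @iter_eq (order rho w)./2 0 w ltac:(lia) o0 e; lia.
Qed.

Lemma ear_end_connect w : fconnect rho w (ear_end w).
Proof. exact: fconnect_iter. Qed.

Lemma ear_end_uniq w x :
  beta w = w -> fconnect rho w x -> beta x = x -> x = w \/ x = ear_end w.
Proof.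
move=> bw cx; rewrite -(iter_findex cx); set k := findex _ _ _.
have lk : k < order rho w by apply: findex_max.
rewrite beta_iter //; last exact: ltnW.
case: (posnP k) => [-> _|k0 e]; first by left.
right; have := @iter_eq (order rho w - k) k w ltac:(lia) lk e => ek.
rewrite /ear_end; congr iter; have := odd_double_half (order rho w); rewrite order_even //; lia.
Qed.

Lemma ear_endK w : beta w = w -> ear_end (ear_end w) = w.
Proof.
move=> bw; have bt := ear_end_fix bw.
case: (@ear_end_uniq w (ear_end (ear_end w)) bw _ (ear_end_fix bt)) => //.
  exact: connect_trans (ear_end_connect w) (ear_end_connect _).
by move/eqP; rewrite (negPf (ear_end_neq bt)).
Qed.

End TwoInvolutions.

(** * Perfect matchings as maps on vertices, and their gluing *)

Section Mates.
Variable G : mgraph.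
Implicit Types (e : edge G) (v w : vert G).

Definition opp e v : vert G := odflt v [pick w in ends e :\ v].

Lemma oppP e v : v \in ends e -> ends e = [set v; opp e v] /\ opp e v != v.
Proof.
move=> ve; have : #|ends e :\ v| = 1.
  by apply/eqP; rewrite -(eqn_add2l 1); have := cardsD1 v (ends e); rewrite ve card_ends => <-.
move/eqP/cards1P=> [w ew]; rewrite /opp; case: pickP => [x|/(_ w)]; last by rewrite ew inE eqxx.
rewrite ew inE => /eqP -> /=; split; last first.
  have : w \in ends e :\ v by rewrite ew inE.
  by rewrite !inE => /andP[].
by rewrite -(setD1K ve) ew.
Qed.

Lemma opp_end e v : v \in ends e -> opp e v \in ends e.
Proof. by move=> /oppP[-> _]; rewrite !inE eqxx orbT. Qed.

Lemma opp_neq e v : v \in ends e -> opp e v != v.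
Proof. by case/oppP. Qed.

Lemma in_ends e v w : v \in ends e -> (w \in ends e) = (w == v) || (w == opp e v).
Proof. by move=> /oppP[-> _]; rewrite !inE. Qed.

Lemma oppK e v : v \in ends e -> opp e (opp e v) = v.
Proof.
move=> ve; have := opp_neq (opp_end ve); have := opp_end (opp_end ve).
by rewrite (in_ends _ ve) => /orP[/eqP //|/eqP ->]; rewrite eqxx.
Qed.

(* A perfect matching, seen as the map sending a vertex to its matching edge. *)
Definition matefun (m : {ffun vert G -> edge G}) : bool :=
  [forall v, (v \in ends (m v)) && [forall w in ends (m v), m w == m v]].

Lemma matefunP (m : {ffun vert G -> edge G}) :
  reflect ((forall v, v \in ends (m v)) /\ (forall v w, w \in ends (m v) -> m w = m v))
          (matefun m).
Proof.
apply: (iffP forallP) => [h|[h1 h2] v].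
  split=> v; first by have /andP[] := h v.
  by move=> w we; have /andP[_ /forall_inP/(_ _ we)/eqP] := h v.
by rewrite h1; apply/forall_inP => w /h2 ->.
Qed.

Lemma pmP (M : {set edge G}) :
  reflect (forall v, exists e, [/\ e \in M, v \in ends e &
             forall f, f \in M -> v \in ends f -> f = e])
          (perfect_matching M).
Proof.
apply: (iffP forallP) => h v.
  have /cards1P[e he] := h v; exists e.
  have : e \in [set e in M | v \in ends e] by rewrite he inE.
  rewrite inE => /andP[eM ve]; split=> // f fM vf.
  by apply/set1P; rewrite -he inE fM.
have [e [eM ve eu]] := h v; apply/cards1P; exists e; apply/setP => f.
rewrite !inE; apply/andP/eqP => [[]|->] //; exact: eu.
Qed.

Lemma matefun_pm m : matefun m -> perfect_matching (m @: setT).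
Proof.
move=> /matefunP[m1 m2]; apply/pmP => v; exists (m v); split=> //; first exact: imset_f.
by move=> _ /imsetP[x _ ->] /m2.
Qed.

Lemma pm_matefun M : perfect_matching M -> exists2 m, matefun m & M = m @: setT.
Proof.
move=> /pmP h; have [f fP] := fin_all_exists h.
have fe v e : e \in M -> v \in ends e -> e = f v by have [_ _] := fP v; apply.
exists [ffun v => f v].
  apply/matefunP; split=> [v|v w]; rewrite !ffunE; first by have [] := fP v.
  by move=> we; apply/esym/fe => //; have [] := fP v.
apply/setP => e; apply/idP/imsetP => [eM|[v _ ->]]; last by rewrite ffunE; have [] := fP v.
have /set0Pn[v ve] : ends e != set0 by rewrite -card_gt0 card_ends.
by exists v => //; rewrite ffunE; apply: fe.
Qed.

Lemma matefun_im m e v : matefun m -> e \in m @: setT -> v \in ends e -> e = m v.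
Proof. by move=> /matefunP[_ m2] /imsetP[x _ ->] /m2. Qed.

Lemma matefun_inj m m' : matefun m -> matefun m' -> m @: setT = m' @: setT -> m = m'.
Proof.
move=> mm mm' e; apply/ffunP => v; apply: (matefun_im mm').
  by rewrite -e imset_f.
by have /matefunP[] := mm.
Qed.

Lemma card_matefun : #|[set m | matefun m]| = #|perfect_matchings G|.
Proof.
rewrite -(card_in_imset (f := fun m : {ffun vert G -> edge G} => m @: setT)); last first.
  by move=> m m'; rewrite !inE => *; apply: matefun_inj.
apply: eq_card => M; rewrite inE; apply/imsetP/idP => [[m]|/pm_matefun[m mm ->]].
  by rewrite inE => /matefun_pm + ->.
by exists m; rewrite ?inE.
Qed.

Definition mate (m : {ffun vert G -> edge G}) v := opp (m v) v.

Section OneMate.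
Variable m : {ffun vert G -> edge G}.
Hypothesis mm : matefun m.

Lemma mf_end v : v \in ends (m v). Proof. by case/matefunP: mm. Qed.
Lemma mf_eq v w : w \in ends (m v) -> m w = m v.
Proof. by case/matefunP: mm => _; apply. Qed.
Lemma mf_mate v : m (mate m v) = m v.
Proof. by apply: mf_eq; apply/opp_end/mf_end. Qed.
Lemma mateK : involutive (mate m).
Proof. by move=> v; rewrite /mate mf_mate oppK // mf_end. Qed.
Lemma mate_neq v : mate m v != v.
Proof. exact/opp_neq/mf_end. Qed.
Lemma mate_end v : mate m v \in ends (m v).
Proof. exact/opp_end/mf_end. Qed.
End OneMate.

Lemma mate_same m m' v : matefun m -> matefun m' -> m v = m' v ->
  m (mate m v) = m' (mate m v) /\ mate m v = mate m' v.
Proof.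
move=> mm mm' e; have e2 : mate m v = mate m' v by rewrite /mate e.
by split=> //; rewrite {2}e2 !mf_mate.
Qed.

(** The common tool for switching along a cycle and for inserting ears: matchings can be mixed
    according to a colouring as soon as each vertex has the colour of its partner in the matching
    selected there. *)
Lemma glue_matefun (I : Type) (c : vert G -> I) (F : I -> {ffun vert G -> edge G}) :
  (forall i, matefun (F i)) -> (forall v, c (mate (F (c v)) v) = c v) ->
  matefun [ffun v => F (c v) v].
Proof.
move=> FF cF; apply/matefunP; split=> [v|v w]; rewrite !ffunE; first exact: mf_end.
rewrite (in_ends _ (mf_end (FF _) v)) => /orP[/eqP -> //|/eqP ->].
by rewrite -/(mate _ _) cF mf_mate.
Qed.

End Mates.

(** * Three perfect matchings along an alternating cycle *)

Section AlternatingCycle.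
Variable G : mgraph.
Variables m0 m1 m2 : {ffun vert G -> edge G}.
Hypotheses (mf0 : matefun m0) (mf1 : matefun m1) (mf2 : matefun m2).
Variable v0 : vert G.
Hypotheses (d01 : m0 v0 != m1 v0) (d02 : m2 v0 != m0 v0) (d12 : m2 v0 != m1 v0).

Let ms (b : bool) := if b then m1 else m0.
Let mfs b : matefun (ms b). Proof. by case: b. Qed.

(** Positions are all natural numbers, read with period [per]. Even positions go forward by [m0] and
    odd ones by [m1], so the parity of a position is the colour on the bipartite cycle. *)
Fixpoint cyc (k : nat) : vert G :=
  if k is k'.+1 then mate (ms (odd k')) (cyc k') else v0.

Let cycS k : cyc k.+1 = mate (ms (odd k)) (cyc k). Proof. by []. Qed.
Let cycP k : cyc k = mate (ms (odd k)) (cyc k.+1). Proof. by rewrite cycS mateK. Qed.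

Let turn v := mate m1 (mate m0 v).
Let turn_inj : injective turn.
Proof. by move=> x y /(can_inj (mateK mf1))/(can_inj (mateK mf0)). Qed.

Let half := order turn v0.
Let per := half.*2.

Let cyc_double t : cyc t.*2 = iter t turn v0.
Proof. by elim: t => //= t ->; rewrite odd_double. Qed.

Let cyc_per : cyc per = v0.
Proof. by rewrite cyc_double (iter_order turn_inj). Qed.

Let per_gt0 : 0 < per. Proof. by rewrite double_gt0 order_gt0. Qed.
Let per_even : odd per = false. Proof. exact: odd_double. Qed.

Let cyc_addper k : cyc (per + k) = cyc k.
Proof.
elim: k => [|k IH]; first by rewrite addn0 cyc_per.
by rewrite addnS !cycS IH oddD per_even.
Qed.

(** If the two vertices were equal, so would be their partners one step inward, since both steps use
    the same matching. The distance drops by 2 until consecutive vertices are reached, which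
    differ. *)
Let cyc_neq_odd d k : cyc k != cyc (k + d.*2.+1).
Proof.
elim: d k => [|d IH] k; first by rewrite addn1 cycS eq_sym mate_neq.
apply/eqP => e; have := IH k.+1; rewrite cycS e.
have -> : k + d.+1.*2.+1 = (k.+1 + d.*2.+1).+1 by lia.
rewrite cycS.
have -> : odd (k.+1 + d.*2.+1) = odd k by rewrite oddD /= odd_double; case: (odd k).
by rewrite mateK // eqxx.
Qed.

(** A coincidence at even distance is pulled back to [v0], where it would make [turn] return before
    its order. *)
Let cyc_inj_lt i j : i < j -> j < per -> cyc i != cyc j.
Proof.
move=> ij jp; case: (boolP (odd (j - i))) => od.
  have -> : j = i + (j - i)./2.*2.+1 by have := odd_double_half (j - i); rewrite od; lia.
  exact: cyc_neq_odd.
have : cyc 0 != cyc (j - i).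
  have e := odd_double_half (j - i); rewrite (negPf od) add0n in e.
  rewrite -e cyc_double /=; apply/eqP => h.
  have lt : (j - i)./2 < order turn v0 by rewrite -/half; move: jp; rewrite /per; lia.
  by have := findex_iter lt; rewrite -h findex0; lia.
apply: contra => /eqP.
elim: i j ij {jp} od => [|i IH] j ij od; first by rewrite subn0 => ->.
case: j ij od => // j ij od; rewrite !cycS subSS.
have -> : odd j = odd i by move: od ij; rewrite subSS; lia.
move/(can_inj (mateK (mfs _))) => e; apply: IH => //; by rewrite subSS in od.
Qed.

Let cyc_inj i j : i < per -> j < per -> cyc i = cyc j -> i = j.
Proof.
move=> ip jp e; case: (ltngtP i j) => // lt.
  by have := cyc_inj_lt lt jp; rewrite e eqxx.
by have := cyc_inj_lt lt ip; rewrite e eqxx.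
Qed.

Let Z := [set cyc i | i : 'I_per].

Let ZP v : reflect (exists2 i, i < per & v = cyc i) (v \in Z).
Proof.
apply: (iffP imsetP) => [[i _ ->]|[i ip ->]]; first by exists i.
by exists (Ordinal ip).
Qed.

Let cyc_Z k : cyc k \in Z.
Proof.
rewrite (divn_eq k per); elim: (k %/ per) => [|q IH].
  by apply/ZP; exists (k %% per) => //; rewrite ltn_mod.
by rewrite mulSn -addnA cyc_addper.
Qed.

Let cyc_pred k : exists2 j, cyc j = mate (ms (~~ odd k)) (cyc k) & odd j = ~~ odd k.
Proof.
case: k => [|k]; last by exists k; rewrite /= negbK //; apply: cycP.
exists per.-1; last by move: per_even per_gt0; case: per => //= p; case: (odd p).
rewrite /= -cyc_per -{2}(prednK per_gt0) /=.
have -> : odd per.-1 = true by move: per_even per_gt0; case: per => //= p; case: (odd p).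
by rewrite mateK.
Qed.

Let Z_mate b v : v \in Z -> mate (ms b) v \in Z.
Proof.
case/ZP=> k _ ->; case: (eqVneq b (odd k)) => [->|ne]; first by rewrite -cycS.
have -> : b = ~~ odd k by move: ne; case: b; case: (odd k).
by have [j <- _] := cyc_pred k.
Qed.

(** An edge common to [m0] and [m1] would propagate back along the cycle to [v0], against [d01]. *)
Let cyc_distinct k : m0 (cyc k) != m1 (cyc k).
Proof.
elim: k => //= k; apply: contra => /eqP; case: (odd k) => /= e; apply/eqP.
  have := mate_same mf1 mf0 (esym e); rewrite mateK // => - [-> _] //.
by have := mate_same mf0 mf1 e; rewrite mateK // => - [-> _].
Qed.

Let sedge k := ms (odd k) (cyc k).
Let sedgeS k : ms (odd k) (cyc k.+1) = sedge k.
Proof. by rewrite cycS mf_mate. Qed.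

Definition branching v := [&& m0 v != m1 v, m2 v != m0 v & m2 v != m1 v].
Let U k := branching (cyc k).

Let UE k : U k.+1 = (m2 (cyc k.+1) != sedge k.+1) && (m2 (cyc k.+1) != sedge k).
Proof.
rewrite /U /branching cyc_distinct -[sedge k]sedgeS /sedge /=.
by case: (odd k); rewrite /= 1?andbC.
Qed.

Let sedge_m2 k : (m2 (cyc k.+1) == sedge k) = (m2 (cyc k) == sedge k).
Proof.
apply/eqP/eqP => e.
  rewrite -e; apply: mf_eq => //; rewrite e; exact: mf_end.
rewrite -e; apply: mf_eq => //; rewrite e /sedge cycS; exact: mate_end.
Qed.

Let sedge_neq k : sedge k.+1 != sedge k.
Proof.
rewrite -[sedge k]sedgeS /sedge /=; have := cyc_distinct k.+1.
by rewrite /=; case: (odd k) => //=; rewrite eq_sym.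
Qed.

Let U0 : U 0. Proof. by rewrite /U /branching d01 d02 d12. Qed.

Let cU k := count U (iota 0 k).
Let cUS k : cU k.+1 = cU k + U k.
Proof. by rewrite /cU -addn1 iotaD count_cat /= addn0. Qed.

(* The vertices of the cycle that do not branch are matched by [m2] along the
   cycle, so branching positions alternate in parity. *)
Let cU_parity k : m2 (cyc k.+1) != sedge k -> odd (cU k.+1) = odd k.+1.
Proof.
have [n] := ubnP k; elim: n k => // n IH k ltn ne.
case: k ltn ne => [|k] ltn ne; first by rewrite cUS U0.
rewrite cUS; case: (boolP (U k.+1)) => Uk.
  by rewrite addn1 /= IH //; move: Uk; rewrite UE => /andP[].
move: Uk; rewrite UE negb_and !negbK -sedge_m2 (negPf ne) /= sedge_m2 => /eqP e.
case: k ltn ne e => [|k] ltn ne e.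
  by move: U0; rewrite /U /branching e /sedge /= eqxx andbF.
have nU : U k.+1 = false by rewrite UE e eqxx.
rewrite addn0 cUS nU addn0 IH /=; first by rewrite negbK.
  exact: ltnW.
by rewrite e sedge_neq.
Qed.

Let cU_U k : U k -> odd (cU k) = odd k.
Proof. by case: k => // k; rewrite UE => /andP[_ /cU_parity]. Qed.

Definition nbranch := cU per.

(** The edge closing the cycle is the [m1]-edge at [v0], which [m2] avoids; so [cU_parity] applies
    to the full period. *)
Let nb_even : ~~ odd nbranch.
Proof.
rewrite /nbranch -(prednK per_gt0) cU_parity ?(prednK per_gt0) ?per_even //.
have od : odd per.-1 by move: per_even per_gt0; case: per => //= p; case: (odd p).
rewrite cyc_per -sedgeS od (prednK per_gt0) cyc_per; exact: d12.
Qed.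

Let us := filter U (iota 0 per).
Let size_us : size us = nbranch. Proof. by rewrite size_filter. Qed.
Let u (i : 'I_nbranch) := nth 0 us i.

Let u_in i : u i \in us. Proof. by rewrite mem_nth // size_us. Qed.
Let u_lt i : u i < per.
Proof. by have := u_in i; rewrite mem_filter mem_iota => /and3P[]. Qed.
Let u_U i : U (u i).
Proof. by have := u_in i; rewrite mem_filter => /andP[]. Qed.
Let us_sorted : sorted ltn us.
Proof. by apply: sorted_filter; [exact: ltn_trans|exact: iota_ltn_sorted]. Qed.

Let u_mono (i j : 'I_nbranch) : (u i < u j) = (i < j).
Proof.
have aux (p q : 'I_nbranch) : p < q -> u p < u q.
  by apply: (sorted_ltn_nth ltn_trans 0 us_sorted); rewrite inE size_us.
case: (ltngtP i j) => [/aux -> //|/aux lt|/val_inj ->]; last by rewrite ltnn.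
by apply/negbTE; rewrite -leqNgt ltnW.
Qed.

Let u_inj : injective u.
Proof.
move=> i j e; apply: val_inj; case: (ltngtP i j) => //; rewrite -u_mono e ltnn //.
Qed.

Let u_surj k : k < per -> U k -> exists i, u i = k.
Proof.
move=> kp Uk; have kus : k \in us by rewrite mem_filter Uk mem_iota.
have lt : index k us < nbranch by rewrite -size_us index_mem.
by exists (Ordinal lt); rewrite /u /= nth_index.
Qed.

Let bS (S : {set 'I_nbranch}) x := #|[set i in S | u i < x]|.
Let Sp (S : {set 'I_nbranch}) x := [exists i in S, u i == x].

Let bS_S S x : bS S x.+1 = bS S x + Sp S x.
Proof.
rewrite /bS; case: (boolP (Sp S x)) => [/exists_inP[i iS /eqP ui]|/exists_inPn none].
  rewrite addn1 (cardsD1 i) inE iS ui ltnSn add1n; congr _.+1.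
  apply: eq_card => j; rewrite !inE; case: (eqVneq j i) => [->|ne] /=.
    by rewrite ui ltnn andbF.
  have : u j != x by rewrite -ui; apply: contra ne => /eqP/u_inj ->.
  by rewrite ltnS leq_eqVlt => /negPf ->.
rewrite addn0; apply: eq_card => j; rewrite !inE.
by case: (boolP (j \in S)) => //= /none /negPf; rewrite ltnS leq_eqVlt => ->.
Qed.

Let bS0 S : bS S 0 = 0.
Proof. by apply/eqP; rewrite cards_eq0; apply/eqP/setP => i; rewrite !inE ltn0 andbF. Qed.

Let bS_per S : bS S per = #|S|.
Proof. by apply: eq_card => i; rewrite !inE u_lt andbT. Qed.

Let bS_u S i : bS S (u i) = before S i.
Proof. by apply: eq_card => j; rewrite !inE u_mono. Qed.

Let cU_bS x : x <= per -> cU x = bS setT x.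
Proof.
elim: x => [|x IH] xp; first by rewrite bS0.
rewrite cUS bS_S IH 1?ltnW //; congr (_ + nat_of_bool _).
apply/idP/exists_inP => [/(u_surj xp)[i <-]|[i _ /eqP <-] //].
by exists i.
Qed.

(** This lets the chord diagram forget the non-branching positions: the parity of an index is still
    the colour on the cycle. *)
Let odd_u i : odd (u i) = odd i.
Proof.
rewrite -cU_U ?u_U // cU_bS 1?ltnW // bS_u; congr odd.
have := @before_compl _ set0 i (ltnW (ltn_ord i)); rewrite setC0.
suff -> : before (set0 : {set 'I_nbranch}) i = 0 by [].
by apply/eqP; rewrite cards_eq0; apply/eqP/setP => j; rewrite !inE.
Qed.

Let alpha := mate m2.
Let beta v := if v \in Z then v else mate m0 v.

Let Z_mateE b v : (mate (ms b) v \in Z) = (v \in Z).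
Proof.
by apply/idP/idP => [/(Z_mate b)|/(Z_mate b) //]; rewrite mateK.
Qed.

Let alphaK : involutive alpha. Proof. exact: mateK. Qed.
Let alpha_neq x : alpha x != x. Proof. exact: mate_neq. Qed.
Let betaK : involutive beta.
Proof.
move=> v; rewrite /beta; case: (boolP (v \in Z)) => [->//|nz].
by rewrite (Z_mateE false) (negPf nz) mateK.
Qed.
Let betaZ v : (beta v == v) = (v \in Z).
Proof. by rewrite /beta; case: ifP => _; rewrite ?eqxx // (negPf (mate_neq mf0 v)). Qed.
Let beta_fix v : v \in Z -> beta v = v.
Proof. by rewrite -betaZ => /eqP. Qed.

Local Notation eend := (ear_end alpha beta).
Local Notation earc := (fconnect (ear_step alpha beta)).

Let nbranching_mate v : v \in Z -> ~~ branching v -> (alpha v \in Z) /\ ~~ branching (alpha v).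
Proof.
move=> vZ nb; have [b eb] : exists b, m2 v = ms b v.
  have : m0 v != m1 v by case/ZP: vZ => k _ ->; apply: cyc_distinct.
  move: nb; rewrite /branching => /nandP[/negbNE/eqP-> /eqP //|/nandP[]/negbNE/eqP e _].
    by exists false.
  by exists true.
have [h1 h2] := mate_same mf2 (mfs b) eb.
split; first by rewrite /alpha h2 Z_mateE.
by rewrite /branching -/alpha /alpha h1; case: b {eb h1 h2} => /=; rewrite eqxx ?andbF.
Qed.

Let eend_Z v : v \in Z -> eend v \in Z.
Proof. by move=> /beta_fix bv; rewrite -betaZ ear_end_fix. Qed.

(** If the far end did not branch, its [m2]-partner would be a non-branching cycle vertex on the
    same ear, hence one of the two ends. It is not [v], which branches, nor the far end itself. *)
Let eend_branching v : v \in Z -> branching v -> branching (eend v).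
Proof.
move=> vZ; apply: contraLR => nb; have bv := beta_fix vZ.
have [aZ na] := nbranching_mate (eend_Z vZ) nb.
case: (@ear_end_uniq _ alpha beta alphaK alpha_neq betaK v (alpha (eend v)) bv).
- exact: ear_alpha alphaK betaK _ _ bv (ear_end_connect _ _ _).
- exact: beta_fix.
- by move=> <-.
- by move/eqP; rewrite (negPf (alpha_neq _)).
Qed.

Let tau_ex i : exists j, cyc (u j) = eend (cyc (u i)).
Proof.
have := eend_branching (cyc_Z (u i)) (u_U i); case/ZP: (eend_Z (cyc_Z (u i))) => k kp ->.
by move=> /(u_surj kp)[j <-]; exists j.
Qed.

Let u_cyc_inj i j : cyc (u i) = cyc (u j) -> i = j.
Proof. by move=> /(cyc_inj (u_lt i) (u_lt j))/u_inj. Qed.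

Section GlueEars.
Variables (tau : 'I_nbranch -> 'I_nbranch) (S : {set 'I_nbranch}).
Hypothesis tauP : forall i, cyc (u (tau i)) = eend (cyc (u i)).
Hypotheses (S_tau : forall i, i \in S -> tau i \in S) (S_even : ~~ odd #|S|).
Variable d : bool.
Hypothesis S_alt : forall i, i \in S -> odd (before S i) = odd i (+) d.

Let ears := [set v | [exists i in S, earc (cyc (u i)) v]].

Let earsP v : reflect (exists2 i, i \in S & earc (cyc (u i)) v) (v \in ears).
Proof. by rewrite inE; apply: exists_inP. Qed.

Let ears_Z k : k < per -> (cyc k \in ears) = Sp S k.
Proof.
move=> kp; apply/earsP/exists_inP => [[i iS ci]|[i iS /eqP <-]]; last by exists i.
case: (@ear_end_uniq _ alpha beta alphaK alpha_neq betaK _ _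
  (beta_fix (cyc_Z (u i))) ci (beta_fix (cyc_Z k))).
  by move=> /(cyc_inj kp (u_lt i)) ->; exists i.
rewrite -tauP => /(cyc_inj kp (u_lt _)) ->; exists (tau i); rewrite ?eqxx //; exact: S_tau.
Qed.

(* On the cycle outside the chosen ears, use [m1] where [col] holds and [m0]
   elsewhere; the colour changes exactly at the ends of the chosen ears. *)
Let col k := odd (bS S k) (+) d.

Let col_Sp k : Sp S k -> col k = odd k.
Proof.
case/exists_inP=> i iS /eqP <-; rewrite /col bS_u S_alt // odd_u.
by rewrite -addbA addbb addbF.
Qed.

Let colS k : ~~ Sp S k -> col k.+1 = col k.
Proof. by move=> /negPf h; rewrite /col bS_S h addn0. Qed.

Let colS_Sp k : Sp S k -> col k.+1 = ~~ col k.
Proof. by move=> h; rewrite /col bS_S h addn1 /= addNb. Qed.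

Let col_per : col per = col 0.
Proof. by rewrite /col bS_per bS0 (negPf S_even). Qed.

(** When colour and parity agree, the selected matching leads from [k] to [k.+1]. That position
    cannot end a chosen ear, because its colour would then be its own parity. *)
Let forward k : ~~ Sp S k -> col k = odd k -> ~~ Sp S k.+1 /\ col k.+1 = col k.
Proof.
move=> nS ck; have e := colS nS; split=> //.
by apply/negP => /col_Sp; rewrite e ck /=; case: (odd k).
Qed.

Let backward k : ~~ Sp S k.+1 -> col k.+1 != odd k.+1 -> ~~ Sp S k /\ col k = col k.+1.
Proof.
move=> nS ck; case: (boolP (Sp S k)) => h.
  by move: ck; rewrite colS_Sp // col_Sp // eqxx.
by rewrite colS.
Qed.

Let pos v := index v [seq cyc k | k <- iota 0 per].

Let pos_cyc k : k < per -> pos (cyc k) = k.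
Proof.
move=> kp; have eqk : cyc k = nth v0 [seq cyc k | k <- iota 0 per] k.
  by rewrite (nth_map 0) ?size_iota // nth_iota.
rewrite /pos {1}eqk index_uniq ?size_map ?size_iota //.
rewrite map_inj_in_uniq ?iota_uniq // => i j; rewrite !mem_iota /= add0n.
exact: cyc_inj.
Qed.

(** [None] stands for [m2], used on the chosen ears. Off the ears and the cycle the value is
    [Some false], so that [m0] is left in place. *)
Let choice v : option bool :=
  if v \in ears then None else Some ((v \in Z) && col (pos v)).
Let F (c : option bool) := if c is Some b then ms b else m2.

Let choice_cyc k : k < per -> choice (cyc k) = if Sp S k then None else Some (col k).
Proof. by move=> kp; rewrite /choice ears_Z // cyc_Z pos_cyc. Qed.

(** Off the cycle, ears are closed under the partners of both [m2] and [m0]. On it, an ear end is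
    matched within its ear, and the other positions are handled by [forward] and [backward]. *)
Let choice_ok v : choice (mate (F (choice v)) v) = choice v.
Proof.
case: (boolP (v \in Z)) => vZ; last first.
  rewrite {2 3}/choice (negPf vZ) /=; case: ifP => /= [/earsP[i iS ci]|nv].
    have bi := beta_fix (cyc_Z (u i)).
    rewrite /choice ifT //; apply/earsP; exists i => //.
    exact: ear_alpha alphaK betaK _ _ bi ci.
  rewrite /choice (Z_mateE false) (negPf vZ) /= ifF //; apply/negP => /earsP[i iS ci].
  have bi := beta_fix (cyc_Z (u i)); case/negP: nv; apply/earsP; exists i => //.
  have := ear_beta alphaK betaK bi ci.
  by rewrite /beta (Z_mateE false) (negPf vZ) mateK.
case/ZP: vZ => k kp ->; rewrite choice_cyc //.
case: (boolP (Sp S k)) => [Sk|nS] /=.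
  have : cyc k \in ears by rewrite ears_Z.
  case/earsP=> i iS ci; rewrite /choice ifT //; apply/earsP; exists i => //.
  exact: ear_alpha alphaK betaK _ _ (beta_fix (cyc_Z (u i))) ci.
case: (eqVneq (col k) (odd k)) => ck.
  have [nS' ck'] := forward nS ck; rewrite ck -cycS.
  have [ek|lt] := eqVneq k.+1 per; last first.
    by rewrite choice_cyc ?(negPf nS') ?ck' ?ck // ltn_neqAle lt.
  rewrite ek cyc_per -[v0]/(cyc 0) choice_cyc // -col_per -ek ck' ck ifF //.
  apply: negbTE; apply/negP => S0; have := col_Sp S0; rewrite -col_per -ek ck' ck /= => ok.
  by have := per_even; rewrite -ek /= ok.
(* Going backward from position 0 wraps around to [per.-1]; the colours fit by [col_per], that is,
   because [S] has even size. *)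
case: k kp nS ck => [|k] kp nS ck.
  have pk := prednK per_gt0; have op : odd per.-1 by have := per_even; rewrite -{1}pk /= => /negbFE.
  have c0 : col 0 = true by move: ck; case: (col 0).
  have nSp : ~~ Sp S per.-1.
    apply/negP => h; have := colS_Sp h; rewrite pk col_per c0 col_Sp // op //.
  have -> : mate (ms (col 0)) (cyc 0) = cyc per.-1.
    by rewrite c0 [RHS]cycP op pk cyc_per.
  rewrite choice_cyc ?(negPf nSp) ?prednK //.
  by rewrite -(colS nSp) pk col_per.
have [nS' ck'] := backward nS ck.
have -> : mate (ms (col k.+1)) (cyc k.+1) = cyc k.
  rewrite [RHS]cycP; congr (mate (ms _) _); move: ck => /=.
  by case: (col k.+1); case: (odd k).
by rewrite choice_cyc ?(negPf nS') ?ck' // ltnW.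
Qed.

(** At a branching vertex the three matchings use distinct edges, so [S] can be read off the glued
    matching. This makes the alternating sets no more numerous than the matchings. *)
Lemma glue_ears : exists2 m, matefun m &
  forall i, (m (cyc (u i)) == m2 (cyc (u i))) = (i \in S).
Proof.
exists [ffun v => F (choice v) v].
  by apply: glue_matefun choice_ok => - [b|] //=; apply: mfs.
move=> i; rewrite ffunE choice_cyc //.
have -> : Sp S (u i) = (i \in S).
  apply/exists_inP/idP => [[j jS /eqP/u_inj <-] //|iS]; by exists i.
case: (i \in S); rewrite ?eqxx //=.
by have /and3P[_ h1 h2] := u_U i; apply/negbTE; rewrite eq_sym; case: (col _).
Qed.

End GlueEars.

Lemma nbranch_bound N :
  #|[set m | @matefun G m]| <= N -> nbranch < (4 * N).+1 * (2 * (5 * N + 2)).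
Proof.
move=> leN; have [tau tauP] := fin_all_exists tau_ex.
have tauK : involutive tau.
  by move=> i; apply: u_cyc_inj; rewrite !tauP ear_endK // beta_fix.
have tau_neq i : tau i != i.
  have := ear_end_neq alphaK alpha_neq betaK (beta_fix (cyc_Z (u i))).
  by rewrite -tauP; apply: contra => /eqP ->.
apply: (chord_bound tauK tau_neq nb_even); apply: leq_trans leN.
apply: (@card_rel_inj_in _ _ _ _ (fun (S : {set 'I_nbranch}) (m : {ffun vert G -> edge G}) =>
   forall i, (m (cyc (u i)) == m2 (cyc (u i))) = (i \in S))).
  move=> S; rewrite inE => /alternatingP[cS eS [d dS]].
  by have [m mm mS] := glue_ears tauP cS eS dS; exists m; rewrite ?inE.
by move=> S S' m mS mS'; apply/setP => i; rewrite -mS mS'.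
Qed.

Definition two_mates : rel (vert G) := fun x y => (y == mate m0 x) || (y == mate m1 x).

Lemma card_branching_cycle :
  #|[set v | connect two_mates v0 v & branching v]| <= nbranch.
Proof.
have conn v : connect two_mates v0 v -> v \in Z.
  case/connectP=> p + ->; have := cyc_Z 0; rewrite /=.
  elim: p v0 => //= y p IH x xZ /andP[xy]; apply: IH.
  by case/orP: xy => /eqP ->; [apply: (Z_mate false)|apply: (Z_mate true)].
apply: (@leq_trans #|[set cyc (u i) | i : 'I_nbranch]|); last first.
  by apply: leq_trans (leq_imset_card _ _) _; rewrite card_ord.
apply: subset_leq_card; apply/subsetP => v; rewrite inE => /andP[/conn/ZP[k kp ->]].
by move=> /(u_surj kp)[i <-]; apply: imset_f.
Qed.

End AlternatingCycle.

(** The cube counts triples of [m1], [m2] and the switched matching; the other factor is the chord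
    bound on branching vertices of a single cycle. *)
Definition branch_const N := N ^ 3 * ((4 * N).+1 * (2 * (5 * N + 2))).

(** * Bounding the degrees and the number of vertices of degree at least 3 *)

Section BranchBound.
Variables (G : mgraph) (N : nat).
Hypothesis pmN : #|perfect_matchings G| <= N.
Hypothesis covered : forall e : edge G, exists2 M, perfect_matching M & e \in M.
Let mfN : #|[set m | @matefun G m]| <= N. Proof. by rewrite card_matefun. Qed.

Lemma matefun_covered (e : edge G) v : v \in ends e -> exists2 m, matefun m & m v = e.
Proof.
move=> ve; have [M /pm_matefun[m mm ->] eM] := covered e.
by exists m => //; rewrite (matefun_im mm eM ve).
Qed.

(** Every edge at [v] lies in a perfect matching, and different edges at [v] lie in different
    ones. *)
Lemma degree_bound (v : vert G) : #|[set e : edge G | v \in ends e]| <= N.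
Proof.
apply: leq_trans mfN.
apply: (@card_rel_inj_in _ _ _ _ (fun e (m : {ffun vert G -> edge G}) => m v = e)).
  move=> e; rewrite inE => ve; have [m mm me] := matefun_covered ve.
  by exists m; rewrite ?inE.
by move=> e e' m <- <-.
Qed.

Section Swap.
Variables m0 m1 : {ffun vert G -> edge G}.
Hypotheses (mf0 : matefun m0) (mf1 : matefun m1).
Definition swap v := [ffun w => (if connect (two_mates m0 m1) v w then m1 else m0) w].

Lemma swap_matefun v : matefun (swap v).
Proof.
have := @glue_matefun G bool (connect (two_mates m0 m1) v) (fun b => if b then m1 else m0).
apply; first by case.
move=> w; have sym : symmetric (two_mates m0 m1).
  move=> x y; rewrite /two_mates.
  by congr (_ || _); apply/eqP/eqP => ->; rewrite mateK.
set y := mate _ _.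
have wy : two_mates m0 m1 w y by rewrite /y /two_mates; case: ifP => _; rewrite eqxx ?orbT.
apply/idP/idP => h; apply: connect_trans h (connect1 _) => //.
by rewrite sym.
Qed.

Lemma swap_eq v w : m0 w != m1 w -> swap v = swap w -> connect (two_mates m0 m1) v w.
Proof.
move=> ne /ffunP/(_ w); rewrite !ffunE connect0; case: ifP => // _ e.
by rewrite e eqxx in ne.
Qed.
End Swap.

(* The switched matching [swap m0 m1 v] determines the cycle through [v]. *)
Lemma card_branch : (exists M : {set edge G}, perfect_matching M) ->
  #|[set v : vert G | 2 < #|[set e | v \in ends e]|]| <= branch_const N.
Proof.
case=> M0 /pm_matefun[m0 mm0 _].
pose P := [set m : {ffun vert G -> edge G} | matefun m].
pose F (t : {ffun vert G -> edge G} * {ffun vert G -> edge G} * {ffun vert G -> edge G}) :=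
  [set v | branching m0 t.1.1 t.1.2 v & t.2 == swap m0 t.1.1 v].
apply: (@leq_trans (#|setX (setX P P) P| * ((4 * N).+1 * (2 * (5 * N + 2))))); last first.
  rewrite !cardsX /branch_const; apply: leq_mul => //.
  by rewrite !expnS expn0 muln1 mulnA; do !apply: leq_mul.
apply: (@card_bigcup_le _ _ _ F).
- move=> v; rewrite inE => d3.
  have [e1 /andP[ve1 n1]] : exists e1, (v \in ends e1) && (e1 != m0 v).
    have : 0 < #|[set e | v \in ends e] :\ m0 v|.
      by have := cardsD1 (m0 v) [set e | v \in ends e]; move: d3; case: (_ \in _); lia.
    by case/card_gt0P=> e; rewrite !inE andbC; exists e.
  have [e2 /and3P[ve2 n2 n3]] : exists e2, [&& v \in ends e2, e2 != m0 v & e2 != e1].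
    have : 0 < #|[set e | v \in ends e] :\ m0 v :\ e1|.
      have := cardsD1 (m0 v) [set e | v \in ends e].
      have := cardsD1 e1 ([set e | v \in ends e] :\ m0 v).
      by move: d3; case: (_ \in _); case: (_ \in _); lia.
    by case/card_gt0P=> e; rewrite !inE => /and3P[? ? ?]; exists e; apply/and3P.
  have [m1 mm1 me1] := matefun_covered ve1; have [m2 mm2 me2] := matefun_covered ve2.
  exists (m1, m2, swap m0 m1 v); first by rewrite !inE /= mm1 mm2 swap_matefun.
  by rewrite inE /branching /= me1 me2 eqxx n2 n3 eq_sym n1.
- move=> [[m1 m2] q]; rewrite !inE /= => /andP[/andP[mm1 mm2] _].
  case: (set_0Vmem (F (m1, m2, q))) => [->|[v0]]; first by rewrite cards0.
  rewrite inE /= => /andP[/and3P[b1 b2 b3] /eqP eq_q].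
  apply: leq_trans (ltnW (nbranch_bound mm0 mm1 mm2 b1 b2 b3 mfN)).
  apply: leq_trans (card_branching_cycle m2 mm0 mm1 v0).
  apply: subset_leq_card; apply/subsetP => v; rewrite !inE /= => /andP[bv /eqP ev].
  rewrite bv andbT; apply: swap_eq; first by case/and3P: bv.
  by rewrite -eq_q -ev.
Qed.

End BranchBound.

Definition few_matchings (N : nat) (G : mgraph) : Prop :=
  [/\ exists M : {set edge G}, perfect_matching M,
      #|perfect_matchings G| <= N
    & forall e : edge G, exists2 M, perfect_matching M & e \in M].

Definition min_degree2 (G : mgraph) : Prop :=
  forall v : vert G, 1 < #|[set e | v \in ends e]|.

Lemma card_sub_set (T : finType) (P : pred T) (A : {set T}) :
  {subset A <= P} -> #|[set w : {x | P x} | val w \in A]| = #|A|.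
Proof.
move=> sAP; rewrite -(card_imset _ val_inj); apply: eq_card => x.
apply/imsetP/idP => [[w]|xA]; first by rewrite inE => wA ->.
by exists (Sub x (sAP x xA)); rewrite ?inE SubK.
Qed.

Lemma walk_edges_uniq (G : mgraph) (x : vert G) s :
  is_walk x s -> uniq (x :: unzip2 s) -> uniq (unzip1 s).
Proof.
have mem h : forall (x : vert G) s, is_walk x s -> h \in unzip1 s ->
    {subset ends h <= x :: unzip2 s}.
  move=> {}x {}s; elim: s x => [|[e y] s IH] x //= /andP[/eqP ee ws].
  rewrite inE => /orP[/eqP ->|hs] w.
    by rewrite ee !inE => /orP[/eqP->|/eqP->]; rewrite eqxx ?orbT.
  by move=> /(IH _ ws hs) wy; rewrite inE wy orbT.
elim: s x => [|[e y] s IH] x //= /andP[/eqP ee ws] /andP[xs us].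
rewrite (IH y ws us) andbT; apply: contra xs => es.
by apply: (mem e _ _ ws es); rewrite ee !inE eqxx.
Qed.

Lemma mem_path_inner (G : mgraph) (x : vert G) s w :
  uniq (x :: unzip2 s) ->
  (w \in path_inner x s) = (w \in unzip2 s) && (w != path_end x s).
Proof.
rewrite /path_inner /path_end; case: (unzip2 s) => [|y t] //.
rewrite cons_uniq -[behead _]/(belast y t) -[last x _]/(last y t) => /andP[_].
rewrite lastI rcons_uniq mem_rcons inE => /andP[+ _].
case: (eqVneq w (last y t)) => [->|_] /=; first by move/negPf->.
by rewrite andbT.
Qed.

(** * Suppressing two adjacent vertices of degree 2 *)

Section Suppress.
Variables (G : mgraph) (a u v b : vert G) (e1 e2 e3 : edge G).
Hypotheses (end1 : ends e1 = [set a; u]) (end2 : ends e2 = [set u; v])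
           (end3 : ends e3 = [set v; b]).
Hypotheses (edges_u : forall e, u \in ends e -> e \in [:: e1; e2])
           (edges_v : forall e, v \in ends e -> e \in [:: e2; e3]).
Hypotheses (a_uv : a \notin [:: u; v]) (b_uv : b \notin [:: u; v]) (ab : a != b).

Let keptv w := w \notin [:: u; v].
Let kepte e := e \notin [:: e2; e3].
Local Notation V' := {w | keptv w}.
Local Notation E' := {e | kepte e}.

(** The name [e1] is reused for the new edge from [a] to [b], so the edges of the smaller graph form
    a subtype of those of [G]. *)
Definition sup_set (e : E') : {set vert G} :=
  if val e == e1 then [set a; b] else ends (val e).

Definition sup_ends (e : E') : {set V'} := [set w | val w \in sup_set e].

Lemma sup_set_kept e : {subset sup_set e <= keptv}.
Proof.
move=> w; rewrite /sup_set; case: eqP => [_|ne].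
  by rewrite !inE => /orP[]/eqP->.
have := valP e; rewrite /kepte !inE negb_or => /andP[n2 n3] we.
rewrite -topredE /= /keptv !inE; apply/norP; split; apply/eqP => ew.
  by move: we; rewrite ew => /edges_u; rewrite !inE (negPf n2) orbF => /eqP.
by move: we; rewrite ew => /edges_v; rewrite !inE (negPf n2) (negPf n3).
Qed.

Lemma card_sup_ends e : #|sup_ends e| = 2.
Proof.
rewrite card_sub_set; last exact: sup_set_kept.
by rewrite /sup_set; case: ifP => _; [rewrite cards2 ab|rewrite card_ends].
Qed.

Definition suppress : mgraph := MGraph card_sup_ends.

Let a_e1 : a \in ends e1. Proof. by rewrite end1 !inE eqxx. Qed.
Let b_e3 : b \in ends e3. Proof. by rewrite end3 !inE eqxx orbT. Qed.
Let u_neq_a : u != a. Proof. by move: a_uv; rewrite !inE eq_sym => /norP[]. Qed.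
Let v_neq_a : v != a. Proof. by move: a_uv; rewrite !inE [v == _]eq_sym => /norP[]. Qed.
Let u_neq_b : u != b. Proof. by move: b_uv; rewrite !inE eq_sym => /norP[]. Qed.
Let v_neq_b : v != b. Proof. by move: b_uv; rewrite !inE [v == _]eq_sym => /norP[]. Qed.
Let u_neq_v : u != v.
Proof. by have := card_ends e2; rewrite end2 cards2; case: eqP. Qed.
Let e1_neq2 : e1 != e2.
Proof.
by apply/eqP => e; move: a_e1; rewrite e end2 => /set2P[]/eqP; rewrite eq_sym
  ?(negPf u_neq_a) ?(negPf v_neq_a).
Qed.
Let e1_neq3 : e1 != e3.
Proof.
apply/eqP => e; move: a_e1; rewrite e end3 => /set2P[]/eqP; last by rewrite (negPf ab).
by rewrite eq_sym (negPf v_neq_a).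
Qed.
Let e2_neq3 : e2 != e3.
Proof.
by apply/eqP => e; move: b_e3; rewrite -e end2 => /set2P[]/eqP; rewrite eq_sym
  ?(negPf u_neq_b) ?(negPf v_neq_b).
Qed.

Let kept1 : kepte e1. Proof. by rewrite /kepte !inE negb_or e1_neq2. Qed.
Definition sup_edge : edge suppress := Sub e1 kept1.

(* The edge of [G] at [w] that becomes the edge [f] of [suppress] at [w]. *)
Definition orig (w : vert suppress) (f : edge suppress) : edge G :=
  if f == sup_edge then (if val w == b then e3 else e1) else val f.

Let sup_edgeE (f : edge suppress) : (val f == e1) = (f == sup_edge).
Proof. by []. Qed.

Lemma mem_sup_ends (w : vert suppress) (f : edge suppress) :
  (w \in ends f) = (val w \in ends (orig w f)).
Proof.
rewrite /= inE /sup_set /orig sup_edgeE; case: ifP => // _.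
have := valP w; rewrite /keptv !inE => /norP[wu wv].
case: ifP => wb; rewrite ?end1 ?end3 !inE.
  by rewrite wb !orbT.
by rewrite -![sval w]/(val w) (negPf wu).
Qed.

Let kept_val (f : edge suppress) : val f != e2 /\ val f != e3.
Proof. by have := valP f; rewrite /kepte !inE => /norP[]. Qed.

Lemma orig_inj w : injective (orig w).
Proof.
move=> f g; rewrite /orig; have [f2 f3] := kept_val f; have [g2 g3] := kept_val g.
case: (eqVneq f sup_edge) => [->|nf]; case: (eqVneq g sup_edge) => [->|ng] //.
- case: ifP => _ e; first by move: g3; rewrite -e eqxx.
  by move: ng; rewrite -sup_edgeE -e eqxx.
- case: ifP => _ e; first by move: f3; rewrite e eqxx.
  by move: nf; rewrite -sup_edgeE e eqxx.
- exact: val_inj.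
Qed.

Lemma orig_surj (w : vert suppress) e : val w \in ends e -> exists f, orig w f = e.
Proof.
have := valP w; rewrite /keptv !inE => /norP[wu wv] we.
have [ee|n3] := eqVneq e e3.
  exists sup_edge; rewrite /orig eqxx ee; move: we; rewrite ee end3 !inE (negPf wv) /=.
  by move=> ->.
have n2 : e != e2.
  by apply/eqP => ee; move: we; rewrite ee end2 !inE (negPf wu) (negPf wv).
have ke : kepte e by rewrite /kepte !inE negb_or n2.
exists (Sub e ke); rewrite /orig -sup_edgeE SubK; case: eqP => // ee.
move: we; rewrite ee end1 !inE (negPf wu) orbF => /eqP ->.
by rewrite (negPf ab).
Qed.

Lemma card_orig (M : {set edge G}) (M' : {set edge suppress}) (w : vert suppress) :
  (forall f, w \in ends f -> (orig w f \in M) = (f \in M')) ->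
  #|[set e in M | val w \in ends e]| = #|[set f in M' | w \in ends f]|.
Proof.
move=> MM'; rewrite -(card_imset _ (@orig_inj w)); apply: eq_card => e; rewrite inE.
apply/andP/imsetP => [[eM we]|[f + ->]].
  have [f ef] := orig_surj we; exists f => //.
  have wf : w \in ends f by rewrite mem_sup_ends ef.
  by rewrite inE wf -MM' // ef eM.
by rewrite inE => /andP[fM wf]; rewrite MM' // -mem_sup_ends.
Qed.

Lemma suppress_min_degree2 : min_degree2 G -> min_degree2 suppress.
Proof.
move=> dG w; have := dG (val w).
have -> : [set e | val w \in ends e] = [set e in setT | val w \in ends e].
  by apply/setP => e; rewrite !inE.
rewrite (@card_orig _ setT); last by move=> f _; rewrite !inE.
suff -> : [set f in setT | w \in ends f] = [set f | w \in ends f] by [].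
by apply/setP => e; rewrite !inE.
Qed.

Definition down (M : {set edge G}) : {set edge suppress} := [set f | val f \in M].

(** The path is matched by its two outer edges if the new edge is matched, and by its middle edge
    otherwise. *)
Definition up (M : {set edge suppress}) : {set edge G} :=
  [set e | if e == e2 then sup_edge \notin M else
           if e == e3 then sup_edge \in M else
           if insub e is Some f then f \in M else false].

Let u_e1 : u \in ends e1. Proof. by rewrite end1 !inE eqxx orbT. Qed.
Let u_e2 : u \in ends e2. Proof. by rewrite end2 !inE eqxx. Qed.
Let v_e2 : v \in ends e2. Proof. by rewrite end2 !inE eqxx orbT. Qed.
Let v_e3 : v \in ends e3. Proof. by rewrite end3 !inE eqxx. Qed.

(** At [u] and at [v] the only alternative is [e2], so both memberships say that [e2] is not in
    [M]. *)
Lemma pm_e13 (M : {set edge G}) : perfect_matching M -> (e1 \in M) = (e3 \in M).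
Proof.
move=> /pmP pM.
have h x f : x \in ends e2 -> x \in ends f -> f != e2 ->
    (forall e, x \in ends e -> e \in [:: e2; f]) -> (f \in M) = (e2 \notin M).
  move=> x2 xf nf only; have [e [eM xe eu]] := pM x.
  apply/idP/idP => [fM|n2].
    by apply/negP => eM2; move: nf; rewrite (eu _ eM2 x2) (eu _ fM xf) eqxx.
  by have := only e xe; rewrite !inE => /orP[]/eqP ee; rewrite ee in eM; rewrite ?eM // eM in n2.
rewrite (h u e1) // ?(h v e3) // 1?eq_sym //.
by move=> e /edges_u; rewrite !inE orbC.
Qed.

Lemma down_pm (M : {set edge G}) : perfect_matching M -> perfect_matching (down M).
Proof.
move=> pM; apply/forallP => w; rewrite -(@card_orig M).
  by move/forallP: pM; apply.
move=> f _; rewrite inE /orig; case: eqP => [->|//].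
by case: ifP => _; rewrite SubK ?pm_e13.
Qed.

Lemma mem_up (M : {set edge suppress}) f : (val f \in up M) = (f \in M).
Proof.
by rewrite inE; have [/negPf -> /negPf ->] := kept_val f; rewrite valK.
Qed.

Lemma up_pm (M : {set edge suppress}) : perfect_matching M -> perfect_matching (up M).
Proof.
move=> pM; apply/forallP => x.
have up1 : (e1 \in up M) = (sup_edge \in M) by rewrite -mem_up SubK.
have up2 : (e2 \in up M) = (sup_edge \notin M) by rewrite inE eqxx.
have up3 : (e3 \in up M) = (sup_edge \in M) by rewrite inE eq_sym (negPf e2_neq3) eqxx.
have h f : x \in ends e2 -> x \in ends f -> f != e2 -> (f \in up M) = (sup_edge \in M) ->
    (forall e, x \in ends e -> e \in [:: e2; f]) -> #|[set e in up M | x \in ends e]| == 1.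
  move=> x2 xf nf upf only; apply/cards1P; exists (if sup_edge \in M then f else e2).
  apply/setP => e; apply/setIdP/set1P => [[eM /only]|->]; last first.
    by case: ifP => sM; rewrite ?upf ?up2 ?sM.
  rewrite !inE => /orP[]/eqP ee; move: eM; rewrite ee ?upf ?up2; first by move/negPf->.
  by move->.
case: (eqVneq x u) => [xu|xu].
  apply: (h e1); rewrite ?xu // => e /edges_u; by rewrite !inE orbC.
case: (eqVneq x v) => [xv|xv].
  by apply: (h e3); rewrite ?xv // eq_sym.
have kx : keptv x by rewrite /keptv !inE negb_or xu.
pose w : vert suppress := Sub x kx.
have -> : x = val w by rewrite SubK.
rewrite (@card_orig _ M); first by move/forallP: pM; apply.
move=> f _; rewrite /orig; case: eqP => [->|_]; last exact: mem_up.
by case: ifP.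
Qed.

Lemma suppress_few N : few_matchings N G -> few_matchings N suppress.
Proof.
case=> [[M pM] leN cov]; split.
- by exists (down M); apply: down_pm.
- apply: leq_trans leN; rewrite -(card_in_imset (f := up)).
    apply: subset_leq_card; apply/subsetP => _ /imsetP[M' + ->].
    by rewrite !inE; apply: up_pm.
  by move=> M1 M2 _ _ e; apply/setP => f; rewrite -!mem_up e.
- move=> f; have [M' pM' fM] := cov (val f).
  by exists (down M'); [apply: down_pm|rewrite inE].
Qed.

Lemma card_suppress : #|vert suppress| < #|vert G|.
Proof.
rewrite card_sig; apply: proper_card; apply/properP; split; first exact/subsetP.
by exists u => //; rewrite inE /keptv !inE eqxx.
Qed.

(** Edges carry no orientation, so the direction of the inserted path is decided by the end from
    which the walk enters. *)
Definition expand_step (x : vert suppress) (h : edge suppress) (y : vert suppress) :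
    seq (edge G * vert G) :=
  if h == sup_edge then
    if val x == a then [:: (e1, u); (e2, v); (e3, b)] else [:: (e3, v); (e2, u); (e1, a)]
  else [:: (val h, val y)].

Fixpoint expand (x : vert suppress) (s : seq (edge suppress * vert suppress)) :=
  if s is (h, y) :: s' then expand_step x h y ++ expand y s' else [::].

Let val_u (w : vert suppress) : (val w == u) = false.
Proof. by have := valP w; rewrite /keptv !inE => /norP[/negPf]. Qed.
Let val_v (w : vert suppress) : (val w == v) = false.
Proof. by have := valP w; rewrite /keptv !inE => /norP[_ /negPf]. Qed.

Let sup_walk (x y : vert suppress) : ends sup_edge = [set x; y] ->
  (val x = a /\ val y = b) \/ (val x = b /\ val y = a).
Proof.
move=> e.
have xy : x != y by have := card_ends sup_edge; rewrite e cards2; case: eqP.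
have h w : w \in [set x; y] -> val w = a \/ val w = b.
  by rewrite -e /= inE /sup_set SubK eqxx => /set2P.
have hx := h x; have hy := h y; rewrite !inE !eqxx ?orbT in hx hy.
case: (hx isT) => ex; case: (hy isT) => ey; [|by left|by right|];
  by move: xy; rewrite -(inj_eq val_inj) /= ex ey eqxx.
Qed.

Let expand_step_walk (x y : vert suppress) (h : edge suppress) s : ends h = [set x; y] ->
  is_walk (val x) (expand_step x h y ++ s) = is_walk (val y) s.
Proof.
rewrite /expand_step; case: eqP => [->|nh] eh.
  case: (sup_walk eh) => [[-> ->]|[-> ->]].
    by rewrite eqxx /= end1 end2 end3 !eqxx.
  by rewrite eq_sym (negPf ab) /= end1 end2 end3 ![[set _; b]]setUC ![[set u; v]]setUC
     ![[set a; u]]setUC !eqxx.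
rewrite /= (_ : ends (val h) == _) //; apply/eqP/setP => w.
have : val @: ends h = [set val x; val y] by rewrite eh imsetU1 imset_set1.
move=> <-; apply/idP/imsetP => [wh|[w' + ->]].
  have kw : keptv w.
    by apply: (@sup_set_kept h); rewrite /sup_set sup_edgeE; case: eqP.
  by exists (Sub w kw); rewrite ?SubK //= inE /sup_set sup_edgeE; case: eqP.
by rewrite /= inE /sup_set sup_edgeE; case: eqP.
Qed.

Lemma expand_walk (x : vert suppress) s : is_walk x s -> is_walk (val x) (expand x s).
Proof.
elim: s x => [|[h y] s IH] x //= /andP[/eqP eh ws].
by rewrite expand_step_walk // IH.
Qed.

Lemma expand_last (x : vert suppress) s : is_walk x s ->
  path_end (val x) (expand x s) = val (path_end x s).
Proof.
rewrite /path_end; elim: s x => [|[h y] s IH] x //= /andP[/eqP eh ws].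
rewrite /unzip2 map_cat last_cat -/unzip2 -IH //; congr last.
rewrite /expand_step; case: eqP => // e; rewrite e in eh.
by case: (sup_walk eh) => [[-> ->]|[-> ->]]; rewrite ?eqxx // eq_sym (negPf ab).
Qed.

Lemma mem_expand_vert (x : vert suppress) s w : is_walk x s ->
  (w \in unzip2 (expand x s)) =
  (w \in map val (unzip2 s)) || ((w \in [:: u; v]) && (sup_edge \in unzip1 s)).
Proof.
elim: s x => [|[h y] s IH] x //=; first by rewrite andbF.
move=> /andP[/eqP eh ws]; rewrite /unzip2 map_cat mem_cat -/unzip2 IH // !inE.
rewrite /expand_step [sup_edge == h]eq_sym; case: eqP => e /=; last by rewrite inE -orbA.
rewrite e in eh.
case: (sup_walk eh) => [[-> ->]|[-> ->]]; rewrite ?eqxx 1?[b == a]eq_sym ?(negPf ab) /= !inE;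
  case: (w == u); case: (w == v); rewrite ?orbT ?orbF //=.
Qed.

Lemma mem_expand_edge (x : vert suppress) s h : is_walk x s ->
  (h \in unzip1 (expand x s)) =
  if h \in [:: e1; e2; e3] then sup_edge \in unzip1 s else h \in map val (unzip1 s).
Proof.
elim: s x => [|[f y] s IH] x //=; first by rewrite if_same.
move=> /andP[/eqP ef ws]; rewrite /unzip1 map_cat mem_cat -/unzip1 IH // !inE.
rewrite /expand_step [sup_edge == f]eq_sym; case: eqP => e /=; last first.
  rewrite inE; have [f2 f3] := kept_val f; case: ifP => // h123.
  suff -> : (h == val f) = false by [].
  apply/negP => /eqP hf; move: h123; rewrite hf (negPf f2) (negPf f3) !orbF sup_edgeE.
  by move/eqP.
rewrite e in ef *; rewrite SubK.
by case: (sup_walk ef) => [[-> _]|[-> _]]; rewrite ?eqxx 1?[b == a]eq_sym ?(negPf ab) /= !inE;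
  case: (h == e1); case: (h == e2); case: (h == e3); rewrite ?orbT.
Qed.

Lemma expand_odd x s : odd (size (expand x s)) = odd (size s).
Proof.
elim: s x => [|[h y] s IH] x //=; rewrite size_cat oddD IH /expand_step.
by case: ifP => _ /=; [case: ifP => _ /=|]; case: (odd _).
Qed.

(** A path uses the new edge at most once, so [u] and [v] are inserted at most once. *)
Lemma expand_uniq (x : vert suppress) s : is_walk x s -> uniq (x :: unzip2 s) ->
  uniq (val x :: unzip2 (expand x s)).
Proof.
elim: s x => [|[h y] s IH] x ws us //.
have ue := walk_edges_uniq ws us.
move: ws us ue => /= /andP[/eqP eh ws] /andP[xs /andP[ys us]] /andP[hs _].
have := IH y ws; rewrite /= ys us => /(_ isT) /andP[ys0 us'].
have {ys0} ys' : val y \notin unzip2 (expand y s) := ys0.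
have xs' : val x \notin unzip2 (expand y s).
  rewrite mem_expand_vert // negb_or !inE val_u val_v /= andbT.
  by rewrite mem_map; [move: xs; rewrite inE => /norP[]|apply: val_inj].
have xy : val x != val y by move: xs; rewrite inE => /norP[].
rewrite /unzip2 map_cat -/unzip2 cat_uniq us' andbT mem_cat negb_or xs' andbT.
rewrite /expand_step; case: eqP hs => [e|_] hs; last first.
  by rewrite /= has_sym /= orbF ys' andbT inE xy.
rewrite e in eh hs; rewrite -![sval x]/(val x).
have uN : u \notin unzip2 (expand y s).
  rewrite mem_expand_vert // (negPf hs) andbF orbF.
  by apply/mapP => - [w _ /eqP]; rewrite eq_sym val_u.
have vN : v \notin unzip2 (expand y s).
  rewrite mem_expand_vert // (negPf hs) andbF orbF.
  by apply/mapP => - [w _ /eqP]; rewrite eq_sym val_v.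
move: xs' ys' xy; case: (sup_walk eh) => [[-> ->]|[-> ->]];
  rewrite ?eqxx 1?[b == a]eq_sym ?(negPf ab).
  move=> xs' ys' _; rewrite has_sym /= !inE !negb_or uN vN ys' /=.
  by rewrite [a == u]eq_sym [a == v]eq_sym u_neq_a v_neq_a ab u_neq_v u_neq_b v_neq_b.
move=> xs' ys' _; rewrite has_sym /= !inE !negb_or uN vN ys' /=.
by rewrite [b == u]eq_sym [b == v]eq_sym [v == u]eq_sym [b == a]eq_sym
  u_neq_a v_neq_a ab u_neq_v u_neq_b v_neq_b.
Qed.

(** Only the path through the new edge changes: it gains two edges, which keeps its length odd, and
    [u] and [v] become inner vertices of it. *)
Lemma suppress_subdivision H : odd_subdivision H suppress -> odd_subdivision H G.
Proof.
case=> f [start [steps]] /= [f_inj pathP inner_f inner_inj [coverv covere]].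
have wk e : is_walk (start e) (steps e) by have [/andP[]] := pathP e.
have un e : uniq (start e :: unzip2 (steps e)) by have [/andP[]] := pathP e.
have un' e := expand_uniq (wk e) (un e).
have innerP e w : w \in path_inner (val (start e)) (expand (start e) (steps e)) ->
    (exists2 y : vert suppress, w = val y & y \in path_inner (start e) (steps e)) \/
    (w \in [:: u; v]) /\ (sup_edge \in path_edges (steps e)).
  rewrite mem_path_inner // mem_expand_vert // expand_last //.
  case/andP=> /orP[/mapP[y ys ->] ne|/andP[? ?]]; last by right.
  by left; exists y => //; rewrite mem_path_inner // ys; apply: contra ne => /eqP ->.
have innerI e (y : vert suppress) : y \in path_inner (start e) (steps e) ->
    val y \in path_inner (val (start e)) (expand (start e) (steps e)).
  rewrite !mem_path_inner // mem_expand_vert // expand_last // => /andP[ys ne].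
  by rewrite map_f //= (inj_eq val_inj).
have uvI e w : sup_edge \in path_edges (steps e) -> w \in [:: u; v] ->
    w \in path_inner (val (start e)) (expand (start e) (steps e)).
  move=> se wuv; rewrite mem_path_inner // mem_expand_vert // expand_last // wuv.
  have -> : sup_edge \in unzip1 (steps e) by [].
  rewrite orbT; apply/eqP => ew; move: wuv; rewrite ew !inE val_u val_v //.
exists (fun x => val (f x)), (fun e => val (start e)), (fun e => expand (start e) (steps e)).
split.
- by move=> x y /val_inj/f_inj.
- move=> e; have [pe oe ee] := pathP e; split.
  + by rewrite /is_path un' expand_walk.
  + by rewrite expand_odd.
  + by rewrite expand_last // imset_comp -ee imsetU1 imset_set1.
- move=> e w /innerP[[y -> yi]|[wuv _]]; apply/negP => /codomP[x ex].
    by have /negP[] := inner_f e y yi; rewrite (val_inj ex) codom_f.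
  by move: wuv; rewrite ex !inE val_u val_v.
- move=> e e' w /innerP[[y -> yi]|[wuv se]] /innerP[[y' ey yi']|[wuv' se']].
  + by apply: (inner_inj e e' y) => //; rewrite (val_inj ey).
  + by move: wuv'; rewrite !inE val_u val_v.
  + by move: wuv; rewrite ey !inE val_u val_v.
  + by have [e0 [_ eu]] := covere sup_edge; rewrite -(eu e) // -(eu e').
- split=> [w|h].
    case: (boolP (keptv w)) => [kw|]; last first.
      rewrite negbK => wuv; right; have [e [se _]] := covere sup_edge.
      by exists e; apply: uvI.
    have -> : w = val (Sub w kw : vert suppress) by rewrite SubK.
    case: (coverv (Sub w kw)) => [/codomP[x ->]|[e we]]; last by right; exists e; apply: innerI.
    by left; apply: (codom_f (fun x => val (f x))).
  case: (boolP (h \in [:: e1; e2; e3])) => h123.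
    have [e [se eu]] := covere sup_edge; exists e; split.
      by rewrite /path_edges mem_expand_edge // h123.
    by move=> e'; rewrite /path_edges mem_expand_edge // h123 => /eu.
  have kh : kepte h by apply: contra h123; rewrite !inE orbC => /orP[]->; rewrite ?orbT.
  pose h' : edge suppress := Sub h kh; have eh : h = val h' by rewrite SubK.
  have [e [se eu]] := covere h'; exists e; split.
    by rewrite /path_edges mem_expand_edge // (negPf h123) eh map_f.
  move=> e'; rewrite /path_edges mem_expand_edge // (negPf h123) {1}eh.
  by rewrite mem_map; [move/eu|apply: val_inj].
Qed.

End Suppress.

(** The summands bound the vertices of degree at least 3, their neighbours, and the ends of matching
    edges that have a parallel edge. A graph with more vertices has one outside all three
    classes. *)
Definition size_const N := branch_const N + branch_const N * N + N * 2.

(** * Bounded skeletons *)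

Section Irreducible.
Variables (G : mgraph) (N : nat).
Hypotheses (fewG : few_matchings N G) (degG : min_degree2 G).

Let W := [set v : vert G | 2 < #|[set e | v \in ends e]|].
Let nbrs := [set x : vert G | [exists e : edge G, (x \in ends e) && (opp e x \in W)]].

Let card_nbrs : #|nbrs| <= #|W| * N.
Proof.
have [_ pmN cov] := fewG.
apply: (@card_bigcup_le _ _ W (fun w => (fun e => opp e w) @: [set e | w \in ends e])).
  move=> x; rewrite inE => /existsP[e /andP[xe oW]]; exists (opp e x) => //.
  by apply/imsetP; exists e; rewrite ?inE ?oppK ?opp_end.
by move=> w _; apply: leq_trans (leq_imset_card _ _) (degree_bound pmN cov w).
Qed.

Variable m0 : {ffun vert G -> edge G}.
Hypothesis mm0 : matefun m0.
Let digons := [set x : vert G | [exists f, (f != m0 x) && (ends f == ends (m0 x))]].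

(** Exchanging a matching edge for a parallel one gives a perfect matching that differs from [m0] at
    exactly the two ends. Each matching thus accounts for at most two vertices; [F] discards those
    that differ from [m0] more widely. *)
Let card_digons : #|digons| <= N * 2.
Proof.
have [_ pmN _] := fewG.
pose D (q : {ffun vert G -> edge G}) := [set x | q x != m0 x].
pose F q := if #|D q| <= 2 then D q else set0.
apply: (@leq_trans (#|[set m | @matefun G m]| * 2)); last first.
  by rewrite leq_mul2r card_matefun pmN.
apply: (@card_bigcup_le _ _ _ F) => [x|q _]; last first.
  by rewrite /F; case: ifP; rewrite ?cards0.
rewrite inE => /existsP[f /andP[fx /eqP ef]].
pose q := [ffun w => if w \in ends (m0 x) then f else m0 w].
have Dq : D q = ends (m0 x).
  apply/setP => w; rewrite inE ffunE; case: ifP => [wx|_]; last by rewrite eqxx.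
  by rewrite (mf_eq mm0 wx) fx.
exists q; last by rewrite /F Dq card_ends leqnn mf_end.
rewrite inE; apply/matefunP; split=> [v|v w]; rewrite !ffunE; case: ifP => vx.
- by rewrite ef.
- exact: mf_end.
- by rewrite ef => ->.
- move=> wv; case: ifP => wx; last exact: mf_eq.
  have := mf_eq mm0 wv; rewrite (mf_eq mm0 wx) => e; by move: vx; rewrite e mf_end.
Qed.

Let degree2 x : x \notin W -> forall e, x \in ends e ->
  exists f, [/\ f != e, x \in ends f & forall g, x \in ends g -> g \in [:: e; f]].
Proof.
move=> xW e xe; have c1 : #|[set e | x \in ends e] :\ e| = 1.
  move: xW (degG x); rewrite inE (cardsD1 e) inE xe; lia.
have /eqP/cards1P[f ef] := c1.
have : f \in [set e | x \in ends e] :\ e by rewrite ef inE.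
rewrite !inE => /andP[fe xf]; exists f; split=> // g xg; rewrite !inE.
case: (eqVneq g e) => //= ge; have : g \in [set e | x \in ends e] :\ e by rewrite !inE ge.
by rewrite ef inE.
Qed.

Lemma suppressible : size_const N < #|vert G| ->
  exists (a u v b : vert G) (e1 e2 e3 : edge G),
    [/\ ends e1 = [set a; u], ends e2 = [set u; v], ends e3 = [set v; b],
        (forall e, u \in ends e -> e \in [:: e1; e2]) &
        (forall e, v \in ends e -> e \in [:: e2; e3])] /\
    [/\ a \notin [:: u; v], b \notin [:: u; v] & a != b].
Proof.
move=> big; have [exM pmN cov] := fewG.
have cW := card_branch pmN cov exM; rewrite -/W in cW.
have [u] : exists u, u \notin W :|: nbrs :|: digons.
  apply/existsP; rewrite -negb_forall; apply: contraTN big => /forallP all.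
  rewrite -leqNgt -cardsT; have -> : setT = W :|: nbrs :|: digons.
    by apply/setP => x; rewrite inE all.
  apply: leq_trans (leq_card_setU _ _) _; apply: leq_add card_digons.
  apply: leq_trans (leq_card_setU _ _) _; apply: leq_add => //.
  by apply: leq_trans card_nbrs _; rewrite leq_mul2r cW orbT.
rewrite !inE !negb_or -andbA => /and3P[uW /existsPn un /existsPn ud].
(* The neighbour [a] is taken along the matching edge; this choice excludes the triangle below. *)
have ue := mf_end mm0 u; set e := m0 u in ue.
have [f [fe uf only_u]] := @degree2 u ltac:(by rewrite inE) e ue.
pose a := opp e u; pose v := opp f u.
have vf : v \in ends f by apply: opp_end.
have vW : v \notin W by have := un f; rewrite uf.
have [g [gf vg only_v]] := degree2 vW vf.
have uv : v != u by apply: opp_neq.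
have au : a != u by apply: opp_neq.
have ee : ends e = [set a; u] by have [-> _] := oppP ue; rewrite setUC.
have ef : ends f = [set u; v] by have [-> _] := oppP uf.
have av : a != v.
  apply/eqP => av; have := ud f; rewrite -/e fe ef ee av setUC eqxx //.
have ge : g != e.
  by apply: contraTneq vg => ->; rewrite ee !inE eq_sym (negPf av) (negPf uv).
have gu : u \notin ends g.
  by apply/negP => /only_u; rewrite !inE (negPf ge) (negPf gf).
have bg : opp g v \in ends g by apply: opp_end.
exists a, u, v, (opp g v), e, f, g; split.
  by split=> //; have [-> _] := oppP vg.
split; rewrite ?inE ?negb_or ?au ?av ?(opp_neq vg) ?andbT //.
  by apply: contraNneq gu => <-.
(* In a triangle [a u v], the vertex [v] could only be matched to [u] or [a], but [m0] matches these
   two with each other. *)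
apply/eqP => ab.
have ma : m0 a = e by apply: mf_eq => //; rewrite -/e ee !inE eqxx.
have := only_v (m0 v) (mf_end mm0 v); rewrite !inE => /orP[]/eqP mv.
  have := mf_eq mm0 (v := v) (w := u); rewrite mv uf => /(_ isT) me.
  by move: fe; rewrite -me eqxx.
have := mf_eq mm0 (v := v) (w := a); rewrite mv ab bg => /(_ isT) me.
by move: ge; rewrite -me -ab ma eqxx.
Qed.

End Irreducible.

Lemma odd_subdivision_refl G : odd_subdivision G G.
Proof.
have [c cP] : exists c : edge G -> vert G, forall e, c e \in ends e.
  apply: (@fin_all_exists (edge G) (fun=> vert G) (fun e v => v \in ends e)) => e.
  by apply/set0Pn; rewrite -card_gt0 card_ends.
exists id, c, (fun e => [:: (e, opp e (c e))]); split=> //.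
- move=> e; have [ee ne] := oppP (cP e); split=> //.
    by rewrite /is_path /= -ee eqxx inE eq_sym ne.
  by rewrite imset_id /path_end /= -ee.
- split=> [v|h]; first by left; apply: (codom_f id).
  by exists h; split=> [|e]; rewrite /path_edges /= inE // => /eqP.
Qed.

Lemma few_subdivision N G : few_matchings N G -> min_degree2 G ->
  exists H, [/\ few_matchings N H, #|vert H| <= size_const N & odd_subdivision H G].
Proof.
have [n] := ubnP #|vert G|; elim: n G => // n IH G ltn fewG degG.
case: (leqP #|vert G| (size_const N)) => [small|big].
  by exists G; split=> //; apply: odd_subdivision_refl.
have [[M /pm_matefun[m0 mm0 _]] _ _] := fewG.
have [a [u [v [b [e1 [e2 [e3 [[h1 h2 h3 h4 h5] [h6 h7 h8]]]]]]]]] :=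
  suppressible fewG degG mm0 big.
have [H [fewH smallH subH]] := IH (suppress h4 h5 h6 h7 h8)
  (leq_trans (card_suppress h4 h5 h6 h7 h8) ltn)
  (suppress_few h1 h2 h3 h4 h5 h6 h7 h8 fewG)
  (suppress_min_degree2 h1 h2 h3 degG).
by exists H; split=> //; exact: (suppress_subdivision h1 h2 h3 subH).
Qed.

Lemma card_edge_few N G : few_matchings N G -> #|edge G| <= #|vert G| * N.
Proof.
case=> _ pmN cov; rewrite -!cardsT.
apply: (@card_bigcup_le _ _ setT (fun v => [set e | v \in ends e])) => [e _|v _].
  have /set0Pn[v ve] : ends e != set0 by rewrite -card_gt0 card_ends.
  by exists v; rewrite inE.
exact: degree_bound.
Qed.

Lemma surj_inj_bij (A B : finType) (g : A -> B) :
  injective g -> (forall y, exists x, g x = y) -> bijective g.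
Proof.
move=> gI /fin_all_exists[f fP]; exists f => // x; exact: gI.
Qed.

Lemma isomorphic_sym G H : isomorphic G H -> isomorphic H G.
Proof.
case=> f [g [[f' fK f'K] [g' gK g'K] fg]]; exists f', g'; split; [by exists f|by exists g|].
move=> e; rewrite -{2}[e]g'K fg -imset_comp -[LHS]imset_id.
by apply: eq_imset => x /=; rewrite fK.
Qed.

Lemma odd_subdivision_iso K H G : isomorphic K H -> odd_subdivision H G -> odd_subdivision K G.
Proof.
case=> f [g [[f' fK f'K] [g' gK g'K] fg]] [F [start [steps]]] /=.
case=> F_inj pathP inner_F inner_inj [coverv covere].
exists (fun x => F (f x)), (fun e => start (g e)), (fun e => steps (g e)); split.
- by move=> x y /F_inj/(can_inj fK).
- by move=> e; have [? ? ee] := pathP (g e); split=> //; rewrite imset_comp -fg.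
- move=> e v vi; apply: contra (inner_F (g e) v vi) => /codomP[x ->]; exact: codom_f.
- move=> e e' v h h'; apply: (can_inj gK); exact: inner_inj h h'.
- split=> [v|h].
    case: (coverv v) => [/codomP[x ->]|[e he]].
      by left; rewrite -[x]f'K; apply: (codom_f (fun x => F (f x))).
    by right; exists (g' e); rewrite g'K.
  have [e [he eu]] := covere h; exists (g' e); split=> [|e' /eu ->].
    by rewrite g'K.
  by rewrite gK.
Qed.

(** * Finitely many representatives of the graphs of bounded size *)

Section SmallGraphs.
Variables (n m : nat).

(** Graphs over ordinals are encoded by their end functions, which form a finite type and can be
    enumerated. *)
Definition small_data := {ffun 'I_m -> {A : {set 'I_n} | #|A| == 2}}.

Definition small_graph (g : small_data) : mgraph :=
  @MGraph 'I_n 'I_m (fun e => val (g e)) (fun e => eqP (valP (g e))).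

End SmallGraphs.

Lemma small_graph_iso (H : mgraph) :
  exists g : small_data #|vert H| #|edge H|, isomorphic (small_graph g) H.
Proof.
have c2 (e : 'I_#|edge H|) : #|enum_rank @: ends (enum_val e)| == 2.
  by rewrite card_imset ?card_ends //; apply: enum_rank_inj.
exists [ffun e => exist (fun A : {set 'I_#|vert H|} => #|A| == 2) _ (c2 e)].
exists enum_val, enum_val; split.
- exact: enum_val_bij.
- exact: enum_val_bij.
move=> e; rewrite /= ffunE /= -imset_comp -[LHS]imset_id.
by apply: eq_imset => x /=; rewrite enum_rankK.
Qed.

Lemma In_map (T : eqType) (A : Type) (F : T -> A) (s : seq T) t :
  t \in s -> List.In (F t) (map F s).
Proof. by elim: s => //= x s IH; rewrite inE => /orP[/eqP->|/IH]; [left|right]. Qed.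

Definition small_index n m : finType :=
  {i : 'I_n.+1 & {j : 'I_m.+1 & small_data i j}}.

Definition small_graphs n m : seq mgraph :=
  [seq small_graph (tagged (tagged t)) | t : small_index n m].

Lemma small_graphsP n m (H : mgraph) : #|vert H| <= n -> #|edge H| <= m ->
  exists2 K, List.In K (small_graphs n m) & isomorphic K H.
Proof.
rewrite -(ltnS _ n) -(ltnS _ m) => ln lm; have [g gH] := small_graph_iso H.
exists (small_graph g) => //.
pose t : small_index n m := Tagged (fun i : 'I_n.+1 => {j : 'I_m.+1 & small_data i j})
  (i := Ordinal ln) (Tagged (fun j : 'I_m.+1 => small_data (Ordinal ln) j) (i := Ordinal lm) g).
exact: (@In_map _ _ (fun t : small_index n m => small_graph (tagged (tagged t))) _ t
  (mem_enum _ t)).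
Qed.

(** * Splitting off copies of [K2] *)

Section SplitK2.
Variables (G : mgraph) (N : nat).
Hypothesis fewG : few_matchings N G.

Let big (v : vert G) := 1 < #|[set e | v \in ends e]|.
Let inner (e : edge G) := [forall w in ends e, big w].

Let bigP v (e f : edge G) : v \in ends e -> v \in ends f -> e != f -> big v.
Proof.
move=> ve vf ef; rewrite /big (cardsD1 e) inE ve (cardsD1 f) !inE eq_sym ef vf //.
Qed.

Let small_edge v (e f : edge G) : ~~ big v -> v \in ends e -> v \in ends f -> e = f.
Proof. by move=> nb ve vf; apply/eqP; apply: contraNT nb; apply: bigP. Qed.

(** Let a perfect matching contain a second edge at [v]. It avoids [e], so the edge matching [w] is
    different from [e], and [w] has two edges as well. *)
Let big_end (e : edge G) v w : v \in ends e -> w \in ends e -> big v -> big w.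
Proof.
have [_ _ cov] := fewG; move=> ve we bv.
have [f] : exists f, f \in [set e | v \in ends e] :\ e.
  by apply/card_gt0P; move: bv; rewrite /big (cardsD1 e) inE ve.
rewrite !inE => /andP[fe vf].
have [m mm mv] := matefun_covered cov vf.
apply: (@bigP w e (m w)) => //; first exact: mf_end.
apply: contra fe => /eqP e'; have mvw : m v = m w by apply: mf_eq => //; rewrite -e'.
by rewrite -mv mvw e'.
Qed.

Let innerP e v : v \in ends e -> inner e = big v.
Proof.
move=> ve; apply/forall_inP/idP => [h|bv w we]; [exact: h|exact: (big_end ve we bv)].
Qed.

Definition core_ends (e : {e | inner e}) : {set {v | big v}} :=
  [set w | val w \in ends (val e)].

Lemma card_core_ends e : #|core_ends e| = 2.
Proof.
rewrite card_sub_set ?card_ends // => w we.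
by rewrite -topredE /= -(innerP we) (valP e).
Qed.

Definition core : mgraph := MGraph card_core_ends.

Let core_card (M : {set edge G}) (M' : {set edge core}) (w : vert core) :
  (forall f : edge core, (val f \in M) = (f \in M')) ->
  #|[set e in M | val w \in ends e]| = #|[set f in M' | w \in ends f]|.
Proof.
move=> MM'; rewrite -(card_imset _ val_inj); apply: eq_card => e; rewrite inE.
apply/andP/imsetP => [[eM we]|[f + ->]].
  have ie : inner e by rewrite (innerP we) (valP w).
  by exists (Sub e ie); rewrite ?SubK // !inE -MM' SubK eM.
by rewrite !inE -MM' => /andP[].
Qed.

Lemma core_min_degree2 : min_degree2 core.
Proof.
move=> w; have := valP w; rewrite /big.
have -> : [set e | val w \in ends e] = [set e in setT | val w \in ends e].
  by apply/setP => e; rewrite !inE.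
rewrite (@core_card _ setT); last by move=> f; rewrite !inE.
suff -> : [set f in setT | w \in ends f] = [set f | w \in ends f] by [].
by apply/setP => e; rewrite !inE.
Qed.

Let core_down (M : {set edge G}) : {set edge core} := [set f | val f \in M].
(** An edge outside the core is a [K2] component and belongs to every perfect matching, hence the
    default [true]. *)
Let core_up (M : {set edge core}) : {set edge G} :=
  [set e | if insub e is Some f then f \in M else true].

Let core_down_pm M : perfect_matching M -> perfect_matching (core_down M).
Proof.
move=> pM; apply/forallP => w; rewrite -(@core_card M); last by move=> f; rewrite inE.
by move/forallP: pM; apply.
Qed.

Let mem_core_up M (f : edge core) : (val f \in core_up M) = (f \in M).
Proof. by rewrite inE valK. Qed.

Let core_up_pm M : perfect_matching M -> perfect_matching (core_up M).
Proof.
move=> pM; apply/forallP => x; case: (boolP (big x)) => bx.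
  have -> : x = val (Sub x bx : vert core) by rewrite SubK.
  by rewrite (@core_card _ M) => [|f]; [move/forallP: pM; apply|exact: mem_core_up].
have [[M0 /pm_matefun[m0 mm0 _]] _ _] := fewG.
apply/cards1P; exists (m0 x); apply/setP => e; apply/setIdP/set1P => [[_ xe]|->].
  by apply: small_edge bx xe (mf_end mm0 x).
split; last exact: mf_end.
by rewrite inE insubF // (innerP (mf_end mm0 x)) (negPf bx).
Qed.

Lemma core_few : few_matchings N core.
Proof.
have [[M pM] leN cov] := fewG; split.
- by exists (core_down M); apply: core_down_pm.
- apply: leq_trans leN; rewrite -(card_in_imset (f := core_up)).
    apply: subset_leq_card; apply/subsetP => _ /imsetP[M' + ->].
    by rewrite !inE; apply: core_up_pm.
  by move=> M1 M2 _ _ e; apply/setP => f; rewrite -!mem_core_up e.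
- move=> f; have [M' pM' fM] := cov (val f).
  by exists (core_down M'); [apply: core_down_pm|rewrite inE].
Qed.

(** A vertex outside the core has its matching edge as its only edge, so it lies on exactly one
    removed edge; [c] picks the end that corresponds to [true]. *)
Lemma split_K2 : exists n, isomorphic G (dunion core (copies n K2)).
Proof.
pose K := {e : edge G | ~~ inner e}; exists #|{: K}|.
apply: isomorphic_sym.
have [[M0 /pm_matefun[m0 mm0 _]] _ _] := fewG.
have [c cP] : exists c : edge G -> vert G, forall e, c e \in ends e.
  apply: (@fin_all_exists (edge G) (fun=> vert G) (fun e v => v \in ends e)) => e.
  by apply/set0Pn; rewrite -card_gt0 card_ends.
pose ke (i : 'I_#|{: K}|) : edge G := val (enum_val i : K).
have ke_out i : ~~ inner (ke i) := valP (enum_val i).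
pose f (x : vert core + 'I_#|{: K}| * bool) : vert G := match x with
  | inl w => val w | inr (i, t) => if t then c (ke i) else opp (ke i) (c (ke i)) end.
pose g (x : edge core + 'I_#|{: K}| * unit) : edge G := match x with
  | inl e => val e | inr (i, _) => ke i end.
have f_end i t : f (inr (i, t)) \in ends (ke i) by case: t; rewrite /= ?opp_end.
have f_small i t : ~~ big (f (inr (i, t))) by rewrite -(innerP (f_end i t)).
have ke_inj : injective ke by move=> i j /val_inj/enum_val_inj.
exists f, g; split.
- apply: surj_inj_bij => [[w|[i t]] [w'|[j t']]|v].
  + by move=> /val_inj ->.
  + by move=> e; have := f_small j t'; rewrite -e /= (valP w).
  + by move=> e; have := f_small i t; rewrite e /= (valP w').
  + move=> e; have eij : i = j.
      apply: ke_inj; apply: (small_edge (f_small i t)) => //; rewrite e; exact: f_end.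
    subst j; have := opp_neq (cP (ke i)); move: e; case: t; case: t' => //= e /eqP[];
      by [exact: e|exact: esym e].
  + case: (boolP (big v)) => bv; first by exists (inl (Sub v bv)).
    have ve := mf_end mm0 v.
    have nv : ~~ inner (m0 v) by rewrite (innerP ve).
    pose i := enum_rank (Sub (m0 v) nv : K).
    have ki : ke i = m0 v by rewrite /ke /i enum_rankK SubK.
    move: (ve); rewrite (in_ends _ (cP (m0 v))) => /orP[]/eqP ev.
      by exists (inr (i, true)); rewrite /= ki -ev.
    by exists (inr (i, false)); rewrite /= ki -ev.
- apply: surj_inj_bij => [[e|[i []]] [e'|[j []]]|e] /=.
  + by move=> /val_inj ->.
  + by move=> h; have := ke_out j; rewrite -h (valP e).
  + by move=> h; have := ke_out i; rewrite h (valP e').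
  + by move=> /ke_inj ->.
  + case: (boolP (inner e)) => ie; first by exists (inl (Sub e ie)).
    exists (inr (enum_rank (Sub e ie : K), tt)).
    by rewrite /= /ke enum_rankK SubK.
- case=> [e|[i []]] /=.
    rewrite -imset_comp; apply/setP => w; apply/idP/imsetP => [we|[w' + ->]]; last first.
      by rewrite inE.
    have bw : big w by rewrite -(innerP we) (valP e).
    by exists (Sub w bw); rewrite ?inE /= ?SubK.
  rewrite /copies_ends -!imset_comp; apply/setP => w; apply/idP/imsetP => [|[t _ ->]].
    rewrite (in_ends _ (cP (ke i))) => /orP[]/eqP ->; [by exists true|by exists false].
  exact: (f_end i t).
Qed.

End SplitK2.

(** * Consequences of minimality *)

Section Minimal.
Variables (k : nat) (G : mgraph).
Hypotheses (k_gt0 : 0 < k) (minG : minimally_matchable k G).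

Let avoid (e : edge G) := [set M in perfect_matchings G | e \notin M].

Let card_avoid e : #|avoid e| < k.
Proof.
have [_ /(_ e) nm] := minG; rewrite ltnNge; apply/negP => le; apply: nm.
apply: (leq_trans le).
rewrite /matchable.
apply: (@card_rel_inj_in _ _ _ _ (fun (M : {set edge G}) (M' : {set edge (del_edge e)}) =>
  e \notin M /\ forall f : edge (del_edge e), (f \in M') = (val f \in M))).
  move=> M; rewrite !inE => /andP[/pmP pM eM].
  exists [set f | val f \in M]; last by split=> // f; rewrite inE.
  rewrite inE; apply/pmP => v; have [h [hM vh hu]] := pM v.
  have he : h != e by apply: contraNneq eM => <-.
  exists (Sub h he); split; rewrite ?inE ?SubK //= => f.
  by rewrite inE => fM vf; apply: val_inj; rewrite /= (hu _ fM vf).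
move=> M M' D [eM hM] [eM' hM']; apply/setP => f.
have [->|fe] := eqVneq f e; first by rewrite (negPf eM) (negPf eM').
by have := hM (Sub f fe); rewrite hM' SubK.
Qed.

Lemma minimal_few : few_matchings (2 * k) G.
Proof.
have [mG _] := minG; rewrite /matchable in mG; split.
- have /card_gt0P[M] := leq_trans k_gt0 mG; by rewrite inE; exists M.
(* Two different matchings provide a vertex with two edges. Otherwise there is at most one matching,
   and 1 is below [2 * k]. *)
- case: (boolP [exists m : {ffun vert G -> edge G}, exists m' : {ffun vert G -> edge G},
     [&& matefun m, matefun m' & m != m']]).
    case/existsP=> m /existsP[m' /and3P[mm mm' ne]].
    have [v nv] : exists v, m v != m' v.
      apply/existsP; apply: contraR ne => /existsPn h; apply/eqP/ffunP => v.
      by have := h v; rewrite negbK => /eqP.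
    apply: (@leq_trans #|avoid (m v) :|: avoid (m' v)|).
      apply: subset_leq_card; apply/subsetP => M; rewrite !inE => pM.
      rewrite pM /= -negb_and; have /pmP/(_ v)[h [hM vh hu]] := pM.
      apply: contra nv => /andP[h1 h2].
      by rewrite (hu _ h1 (mf_end mm v)) (hu _ h2 (mf_end mm' v)).
    apply: leq_trans (leq_card_setU _ _) _; rewrite mul2n -addnn.
    by apply: leq_add; apply: ltnW.
  move=> /existsPn h; rewrite -card_matefun; apply: (@leq_trans 1); last by lia.
  apply/card_le1_eqP => m m'; rewrite !inE => mm mm'.
  by apply/eqP; have := h m => /existsPn/(_ m'); rewrite mm mm' negbK eq_sym.
- move=> e; case: (boolP [exists M : {set edge G}, perfect_matching M && (e \in M)]).
    by case/existsP=> M /andP[]; exists M.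
  (* An edge in no perfect matching would be avoided by all of them, hence by at least [k]. *)
  move=> /existsPn h; have := card_avoid e; rewrite ltnNge => /negP[].
  apply: (leq_trans mG); apply: subset_leq_card; apply/subsetP => M; rewrite !inE => pM.
  by have := h M; rewrite pM.
Qed.

End Minimal.

Theorem theorem1 (k : nat) (hk : 1 <= k) :
  exists Gs : seq mgraph,
    forall G : mgraph, minimally_matchable k G ->
      exists (H S : mgraph) (n : nat),
        [/\ List.In H Gs,
            odd_subdivision H S
          & isomorphic G (dunion S (copies n K2))].
Proof.
(* With at most [2 * k] matchings all degrees are at most [2 * k], so [s] vertices carry at most
   [s * (2 * k)] edges. *)
pose s := size_const (2 * k); exists (small_graphs s (s * (2 * k))) => G minG.
have fewG := minimal_few hk minG.
have [n isoG] := split_K2 fewG.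
have [H [fewH smallH subH]] := few_subdivision (core_few fewG) (@core_min_degree2 _ _ fewG).
have leE : #|edge H| <= s * (2 * k).
  by apply: leq_trans (card_edge_few fewH) _; rewrite leq_mul2r smallH orbT.
have [K inK isoK] := small_graphsP smallH leE.
by exists K, (core fewG), n; split=> //; apply: odd_subdivision_iso isoK subH.
Qed.
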